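(* Let $\mathcal{C}$ be a quasicategory and $\mathcal{C}_\dagger$ a simplicial subset of $\mathcal{C}$. Then $\mathcal{C}$ is a Waldhausen quasicategory with cofibration quasicategory $co\mathcal{C}=\mathcal{C}_\dagger$ if and only if $(\mathcal{C},\mathcal{C}_\dagger)$ is a Waldhausen $\infty$-category in the sense of Barwick, which means: (i$'$) The simplicial subset $\mathcal{C}_\dagger$ contains $\mathcal{C}_{\mathrm{equiv}}$ and is a ''subcategory'' of $\mathcal{C}$ in the sense that there exists a subcategory $\mathbf{A}$ of $\tau_1\mathcal{C}$ such that the square $$\begin{array}{ccc}\mathcal{C}_\dagger&\hookrightarrow&\mathcal{C}\\ \downarrow&&\downarrow\\ N\mathbf{A}&\hookrightarrow&N\tau_1\mathcal{C}\end{array}$$ is a pullback of simplicial sets. (ii$'$) The quasicategory $\mathcal{C}$ contains a zero object, and for any zero object $0$ and any object $x\in\mathcal{C}_0$, any morphism $0\to x$ is a morphism in $\mathcal{C}_\dagger$. (iii$'$) The pushout of a cofibration (a morphism of $\mathcal{C}_\dagger$) along any morphism exists, and every pushout of a cofibration along any morphism is a cofibration.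
   Context: $\tau_1\mathcal{C}$ is the homotopy category of $\mathcal{C}$ (left adjoint to the nerve $N$), and $\mathcal{C}\to N\tau_1\mathcal{C}$ is the unit. $\mathcal{C}_{\mathrm{equiv}}$ is the maximal Kan subcomplex of $\mathcal{C}$, i.e. the simplicial subset 1-full on the equivalences. A simplicial subset $A\subseteq B$ is 1-full if an $n$-simplex of $B$ lies in $A$ exactly when all its edges lie in $A$. A sub quasicategory is a simplicial subset that is a quasicategory. A Waldhausen quasicategory is a quasicategory $\mathcal{C}$ with zero objects together with a sub quasicategory $co\mathcal{C}$, whose 1-simplices are called cofibrations, such that: (i) $co\mathcal{C}$ is 1-full in $\mathcal{C}$ and contains all equivalences in $\mathcal{C}$; (ii) for each object $A$ of $\mathcal{C}$ and any zero object $\ast$ of $\mathcal{C}$, every morphism $\ast\to A$ is a cofibration; (iii) the pushout of a cofibration along any morphism exists, and every pushout of a cofibration along any morphism is a cofibration. *)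

(* Defs.v *)
From HB Require Import structures.
From mathcomp Require Import all_boot all_order.
From mathcomp Require Import boolp.

Set Implicit Arguments.
Unset Strict Implicit.
Unset Printing Implicit Defensive.

Import Order.TTheory.

Definition delta (m n : nat) := {omorphism 'I_m.+1 -> 'I_n.+1}.

Lemma omorphism_ext d d' (S : porderType d) (T : porderType d')
  (f g : {omorphism S -> T}) : f =1 g -> f = g.
Proof.
case: f g => f [[fle]] [g [[gle]]] /= fg.
have {}fg : f = g by apply: funext.
by subst g; rewrite (Prop_irrelevance fle gle).
Qed.

Definition delta_id n : delta n n := idfun.

Definition delta_comp l m n (g : delta m n) (f : delta l m) : delta l n := g \o f.

Fact vertex_homo n (i : 'I_n.+1) : {homo (fun _ : 'I_1 => i) : x y / (x <= y)%O}.
Proof. by []. Qed.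

Definition vertex_map n (i : 'I_n.+1) : delta 0 n :=
  HB.pack (fun _ : 'I_1 => i) (Order.isOrderMorphism.Build _ _ _ _ _ (vertex_homo i)).

Definition edge_fun n (i j : 'I_n.+1) (t : 'I_2) : 'I_n.+1 :=
  if t == ord0 then i else j.

Fact edge_homo n (i j : 'I_n.+1) :
  (i <= j)%O -> {homo edge_fun i j : x y / (x <= y)%O}.
Proof.
by move=> ij [[|[|x]] // hx] [[|[|y]] // hy]; rewrite /edge_fun //= !leEord.
Qed.

Definition edge_map n (i j : 'I_n.+1) (ij : (i <= j)%O) : delta 1 n :=
  HB.pack (edge_fun i j) (Order.isOrderMorphism.Build _ _ _ _ _ (edge_homo ij)).

Definition degen_map n : delta n 0 :=
  HB.pack (fun _ : 'I_n.+1 => ord0 : 'I_1)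
    (Order.isOrderMorphism.Build _ _ _ _ (fun _ => ord0) (fun _ _ _ => lexx ord0)).

Fact coface_homo n (i : 'I_n.+2) :
  {homo (lift i : 'I_n.+1 -> 'I_n.+2) : x y / (x <= y)%O}.
Proof. by move=> x y; rewrite !leEord /= leq_bump2. Qed.

Definition coface n (i : 'I_n.+2) : delta n n.+1 :=
  HB.pack (lift i : 'I_n.+1 -> 'I_n.+2)
    (Order.isOrderMorphism.Build _ _ _ _ _ (coface_homo i)).

Definition triangle_fun n (i j k : 'I_n.+1) (t : 'I_3) : 'I_n.+1 :=
  nth k [:: i; j] t.

Fact triangle_homo n (i j k : 'I_n.+1) : (i <= j)%O -> (j <= k)%O ->
  {homo triangle_fun i j k : x y / (x <= y)%O}.
Proof.
move=> ij jk; have ik := le_trans ij jk.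
by move=> [[|[|[|x]]] // hx] [[|[|[|y]]] // hy]; rewrite /triangle_fun //= !leEord.
Qed.

Definition triangle_map n (i j k : 'I_n.+1) (ij : (i <= j)%O) (jk : (j <= k)%O) :
    delta 2 n :=
  HB.pack (triangle_fun i j k)
    (Order.isOrderMorphism.Build _ _ _ _ _ (triangle_homo ij jk)).

Record sSet := SSet {
  simp :> nat -> Type;
  act : forall m n, delta m n -> simp n -> simp m;
  act_id : forall n (x : simp n), act (delta_id n) x = x;
  act_comp : forall l m n (f : delta l m) (g : delta m n) (x : simp n),
    act (delta_comp g f) x = act f (act g x)
}.

Record smap (X Y : sSet) := SMap {
  smap_fun :> forall n, X n -> Y n;
  smap_nat : forall m n (f : delta m n) (x : X n),
    smap_fun (act f x) = act f (smap_fun x)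
}.
Arguments smap_fun {X Y} _ {n} _.

Lemma smap_ext X Y (f g : smap X Y) :
  (forall n (x : X n), f n x = g n x) -> f = g.
Proof.
case: f g => f fn [g gn] /= fg.
have {}fg : f = g by apply: functional_extensionality_dep => n; apply: funext.
by subst g; rewrite (Prop_irrelevance fn gn).
Qed.

Definition smap_comp X Y Z (g : smap Y Z) (f : smap X Y) : smap X Z.
Proof.
exists (fun n x => g n (f n x)) => m n h x.
by rewrite !smap_nat.
Defined.

Definition simplex (n : nat) : sSet.
Proof.
exists (fun m => delta m n) (fun l m f g => delta_comp g f).
- by move=> m x; apply: omorphism_ext.
- by move=> l m k f g x; apply: omorphism_ext.
Defined.

Definition simplex_map m n (f : delta m n) : smap (simplex m) (simplex n).
Proof.
exists (fun l g => delta_comp f g) => l k h g.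
exact: omorphism_ext.
Defined.

Record ssubset (X : sSet) := SSubset {
  smem : forall n, X n -> Prop;
  smem_act : forall m n (f : delta m n) (x : X n), smem x -> smem (act f x)
}.
Arguments smem {X} _ {n} _.

Definition ssubset_incl X (A B : ssubset X) : Prop :=
  forall n (x : X n), smem A x -> smem B x.

Definition sset_of_ssubset X (A : ssubset X) : sSet.
Proof.
exists (fun n => {x : X n | smem A x})
  (fun m n f x => exist _ (act f (sval x)) (smem_act f (svalP x))).
- by move=> n [x xA]; apply: eq_exist; rewrite act_id.
- by move=> l m n f g [x xA]; apply: eq_exist; rewrite act_comp.
Defined.
Coercion sset_of_ssubset : ssubset >-> sSet.

Definition ssub_incl X (A : ssubset X) : smap A X.
Proof. by exists (fun n (x : A n) => sval x). Defined.

(* The degenerate edges of x are edges as well, so a 0-simplex belongs to A as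
   soon as its degenerate edge does. *)
Definition one_full X (A : ssubset X) : Prop :=
  forall n (x : X n), smem A x <-> forall e : delta 1 n, smem A (act e x).

Definition boundary n : ssubset (simplex n).
Proof.
exists (fun m (f : simplex n m) => exists j : 'I_n.+1, forall i, f i != j).
by move=> m l g f [j fj]; exists j => i; exact: fj.
Defined.

Definition horn n (k : 'I_n.+1) : ssubset (simplex n).
Proof.
exists (fun m (f : simplex n m) =>
          exists2 j : 'I_n.+1, j != k & forall i, f i != j).
by move=> m l g f [j jk fj]; exists j => // i; exact: fj.
Defined.

Definition is_quasicategory (X : sSet) : Prop :=
  forall n (k : 'I_n.+1), (0 < k < n)%N ->
  forall h : smap (horn k) X,
  exists s : smap (simplex n) X, smap_comp s (ssub_incl (horn k)) = h.

Definition vertex (X : sSet) n (x : X n) (i : 'I_n.+1) : X 0 :=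
  act (vertex_map i) x.

Definition src (X : sSet) (e : X 1) : X 0 := vertex e ord0.
Definition tgt (X : sSet) (e : X 1) : X 0 := vertex e ord_max.

Record edge (X : sSet) (x y : X 0) := Edge {
  edge_val :> X 1;
  edge_src : src edge_val = x;
  edge_tgt : tgt edge_val = y
}.
Arguments edge X x y : clear implicits.

Fact act_edge_src (X : sSet) n (s : X n) (i j : 'I_n.+1) (ij : (i <= j)%O) :
  src (act (edge_map ij) s) = vertex s i.
Proof.
rewrite /src /vertex -act_comp; congr act.
exact: omorphism_ext.
Qed.

Fact act_edge_tgt (X : sSet) n (s : X n) (i j : 'I_n.+1) (ij : (i <= j)%O) :
  tgt (act (edge_map ij) s) = vertex s j.
Proof.
rewrite /tgt /vertex -act_comp; congr act.
exact: omorphism_ext.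
Qed.

Definition face_edge (X : sSet) n (s : X n) (i j : 'I_n.+1) (ij : (i <= j)%O) :
  edge X (vertex s i) (vertex s j) :=
  Edge (act_edge_src s ij) (act_edge_tgt s ij).

Fact degen_vertex (X : sSet) (x : X 0) i : vertex (act (degen_map 1) x) i = x.
Proof.
rewrite /vertex -act_comp -[RHS]act_id; congr act.
by apply: omorphism_ext => j; rewrite [RHS]ord1.
Qed.

Definition degen_edge (X : sSet) (x : X 0) : edge X x x :=
  Edge (degen_vertex x ord0) (degen_vertex x ord_max).

Record category := Category {
  ob :> Type;
  hom : ob -> ob -> Type;
  idm : forall x, hom x x;
  comp : forall x y z, hom y z -> hom x y -> hom x z;
  comp1m : forall x y (f : hom x y), comp (idm y) f = f;
  compm1 : forall x y (f : hom x y), comp f (idm x) = f;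
  compA : forall w x y z (h : hom y z) (g : hom x y) (f : hom w x),
    comp h (comp g f) = comp (comp h g) f
}.
Arguments idm {c} x.
Arguments comp {c x y z} _ _.

Definition is_iso (C : category) (x y : C) (f : hom x y) : Prop :=
  exists g : hom y x, comp g f = idm x /\ comp f g = idm y.

Record functor (C D : category) := Functor {
  fob :> C -> D;
  fhom : forall x y, hom x y -> hom (fob x) (fob y);
  fhom_id : forall x, fhom (idm x) = idm (fob x);
  fhom_comp : forall x y z (g : hom y z) (f : hom x y),
    fhom (comp g f) = comp (fhom g) (fhom f)
}.
Arguments fhom {C D} _ {x y} _.

Definition functor_comp (C D E : category) (G : functor D E) (F : functor C D) :
  functor C E.
Proof.
exists (fun x => G (F x)) (fun x y f => fhom G (fhom F f)).
- by move=> x; rewrite !fhom_id.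
- by move=> x y z g f; rewrite !fhom_comp.
Defined.

Definition arrow (C : category) := {x : C & {y : C & hom x y}}.
Definition arr (C : category) (x y : C) (f : hom x y) : arrow C :=
  existT _ x (existT _ y f).

Lemma existT_injr (T : Type) (P : T -> Type) (x : T) (p q : P x) :
  existT P x p = existT P x q -> p = q.
Proof.
have eq_proj (u v : {x : T & P x}) (uv : u = v) (e : projT1 u = projT1 v) :
    eq_rect _ P (projT2 u) _ e = projT2 v.
  by subst v; rewrite (Prop_irrelevance e erefl).
by move=> pq; exact: (eq_proj _ _ pq erefl).
Qed.

Lemma arr_inj (C : category) (x y : C) (f g : hom x y) : arr f = arr g -> f = g.
Proof. by move=> fg; exact: existT_injr (existT_injr fg). Qed.

Lemma functor_ext (C D : category) (F G : functor C D) :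
  (forall x y (f : hom x y), arr (fhom F f) = arr (fhom G f)) -> F = G.
Proof.
case: F G => [F Fh F1 Fc] [G Gh G1 Gc] /= FG.
have e : F = G by apply: funext => x; exact: (congr1 (@projT1 _ _) (FG x x (idm x))).
subst G.
have e : Fh = Gh.
  do 2![apply: functional_extensionality_dep => ?]; apply: funext => f.
  exact: arr_inj.
by subst Gh; rewrite (Prop_irrelevance F1 G1) (Prop_irrelevance Fc Gc).
Qed.

Definition ordcat (n : nat) : category.
Proof.
exists 'I_n.+1 (fun i j => (i <= j)%O) (fun i => lexx i)
  (fun i j k jk ij => le_trans ij jk) => *; exact: bool_irrelevance.
Defined.

Definition delta_functor m n (f : delta m n) : functor (ordcat m) (ordcat n).
Proof.
exists (f : ordcat m -> ordcat n) (fun i j (ij : (i <= j)%O) => omorph_le f ij)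
  => *; exact: bool_irrelevance.
Defined.

Definition nerve (C : category) : sSet.
Proof.
exists (fun n => functor (ordcat n) C)
  (fun m n f F => functor_comp F (delta_functor f)).
- move=> n F; apply: functor_ext => i j ij /=.
  by congr (arr (fhom F _)); exact: bool_irrelevance.
- move=> l m n f g F; apply: functor_ext => i j ij /=.
  by congr (arr (fhom F _)); exact: bool_irrelevance.
Defined.

Definition nerve_map (C D : category) (F : functor C D) :
  smap (nerve C) (nerve D).
Proof.
exists (fun n (x : nerve C n) => functor_comp F x) => m n f x.
by apply: functor_ext.
Defined.

Record subcategory (C : category) := Subcategory {
  sub_ob : C -> Prop;
  sub_hom : forall x y : C, hom x y -> Prop;
  sub_hom_src : forall x y (f : hom x y), sub_hom f -> sub_ob x;
  sub_hom_tgt : forall x y (f : hom x y), sub_hom f -> sub_ob y;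
  sub_hom_id : forall x, sub_ob x -> sub_hom (idm x);
  sub_hom_comp : forall x y z (g : hom y z) (f : hom x y),
    sub_hom g -> sub_hom f -> sub_hom (comp g f)
}.
Arguments sub_ob {C} _ _.
Arguments sub_hom {C} _ {x y} _.

Definition category_of_subcategory (C : category) (A : subcategory C) : category.
Proof.
exists {x : C | sub_ob A x}
  (fun x y => {f : hom (sval x) (sval y) | sub_hom A f})
  (fun x => exist _ (idm (sval x)) (sub_hom_id (svalP x)))
  (fun x y z g f => exist _ (comp (sval g) (sval f))
                      (sub_hom_comp (svalP g) (svalP f))).
- by move=> x y [f fA]; apply: eq_exist; rewrite comp1m.
- by move=> x y [f fA]; apply: eq_exist; rewrite compm1.
- by move=> w x y z [h hA] [g gA] [f fA]; apply: eq_exist; rewrite compA.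
Defined.
Coercion category_of_subcategory : subcategory >-> category.

Definition subcat_incl (C : category) (A : subcategory C) : functor A C.
Proof.
by exists (fun x : A => sval x) (fun (x y : A) (f : @hom A x y) => sval f).
Defined.

Inductive epath (X : sSet) : X 0 -> X 0 -> Type :=
| pnil x : epath x x
| pcons x y z : edge X x y -> epath y z -> epath x z.
Arguments epath X x y : clear implicits.
Arguments pnil {X} x.
Arguments pcons {X x y z} _ _.

Fixpoint pcat (X : sSet) (x y z : X 0) (p : epath X x y) :
    epath X y z -> epath X x z :=
  match p with
  | pnil _ => fun q => q
  | pcons _ _ _ e p' => fun q => pcons e (pcat p' q)
  end.

Definition is_triangle (X : sSet) (x y z : X 0)
    (f : edge X x y) (g : edge X y z) (h : edge X x z) : Prop :=
  exists s : X 2, [/\ act (coface ord_max) s = f,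
                      act (coface ord0) s = g
                    & act (coface (@Ordinal 3 1 isT)) s = h].

(* The least congruence on the free category on the graph of edges which
   identifies d_1 s with the composite of d_2 s and d_0 s for every 2-simplex s,
   and degenerate edges with identities. *)
Inductive pcong (X : sSet) : forall x y : X 0, epath X x y -> epath X x y -> Prop :=
| pcong_degen x : pcong (pcons (degen_edge x) (pnil x)) (pnil x)
| pcong_triangle x y z (f : edge X x y) (g : edge X y z) (h : edge X x z) :
    is_triangle f g h ->
    pcong (pcons f (pcons g (pnil z))) (pcons h (pnil z))
| pcong_refl x y (p : epath X x y) : pcong p p
| pcong_sym x y (p q : epath X x y) : pcong p q -> pcong q p
| pcong_trans x y (p q r : epath X x y) : pcong p q -> pcong q r -> pcong p r
| pcong_cat x y z (p p' : epath X x y) (q q' : epath X y z) :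
    pcong p p' -> pcong q q' -> pcong (pcat p q) (pcat p' q').

Lemma pcatA (X : sSet) (w x y z : X 0)
  (p : epath X w x) (q : epath X x y) (r : epath X y z) :
  pcat p (pcat q r) = pcat (pcat p q) r.
Proof. by elim: p q => //= ? ? ? e p IHp q; rewrite IHp. Qed.

Lemma pcatp0 (X : sSet) (x y : X 0) (p : epath X x y) : pcat p (pnil y) = p.
Proof. by elim: p => //= ? ? ? e p ->. Qed.

Definition tau1_hom (X : sSet) (x y : X 0) :=
  {P : epath X x y -> Prop | exists p, P = @pcong X x y p}.

Definition tau1_class (X : sSet) (x y : X 0) (p : epath X x y) : tau1_hom x y :=
  exist _ (@pcong X x y p) (ex_intro _ p erefl).

Lemma tau1_classP (X : sSet) (x y : X 0) (p q : epath X x y) :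
  tau1_class p = tau1_class q <-> pcong p q.
Proof.
split=> [[->]|pq]; first exact: pcong_refl.
apply: eq_exist; apply: funext => r; apply: propext.
by split; apply: pcong_trans => //; exact: pcong_sym.
Qed.

Lemma tau1_class_surj (X : sSet) (x y : X 0) (P : tau1_hom x y) :
  exists p, P = tau1_class p.
Proof. by case: P => P [p eP]; exists p; exact: eq_exist. Qed.

Definition tau1_comp (X : sSet) (x y z : X 0) (Q : tau1_hom y z)
  (P : tau1_hom x y) : tau1_hom x z.
Proof.
exists (fun r => exists p q, [/\ sval P p, sval Q q & pcong (pcat p q) r]).
have [[p ->] [q ->]] := (tau1_class_surj P, tau1_class_surj Q).
exists (pcat p q).
apply: funext => r; apply: propext; split=> [[p' [q' /= [pp' qq' r']]]|pqr].
  by apply: pcong_trans r'; exact: pcong_cat.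
by exists p, q; split=> //; exact: pcong_refl.
Defined.

Lemma tau1_comp_class (X : sSet) (x y z : X 0) (p : epath X x y)
  (q : epath X y z) :
  tau1_comp (tau1_class q) (tau1_class p) = tau1_class (pcat p q).
Proof.
apply: eq_exist; apply: funext => r; apply: propext.
split=> [[p' [q' /= [pp' qq' r']]]|pqr].
  by apply: pcong_trans r'; exact: pcong_cat.
by exists p, q; split=> //; exact: pcong_refl.
Qed.

Definition tau1 (X : sSet) : category.
Proof.
exists (X 0) (@tau1_hom X) (fun x => tau1_class (pnil x)) (@tau1_comp X).
- move=> x y f; have [p ->] := tau1_class_surj f.
  by rewrite tau1_comp_class pcatp0.
- move=> x y f; have [p ->] := tau1_class_surj f.
  by rewrite tau1_comp_class.
- move=> w x y z h g f; have [p ->] := tau1_class_surj f.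
  have [q ->] := tau1_class_surj g; have [r ->] := tau1_class_surj h.
  by rewrite !tau1_comp_class pcatA.
Defined.

Definition tau1_edge (X : sSet) (x y : X 0) (e : edge X x y) :
  @hom (tau1 X) x y := tau1_class (pcons e (pnil y)).

Lemma arr_tau1_edge (X : sSet) (x y x' y' : X 0) (e : edge X x y)
  (e' : edge X x' y') :
  e = e' :> X 1 -> arr (tau1_edge e) = arr (tau1_edge e').
Proof.
case: e e' => [e ex ey] [e' ex' ey'] /= ee'; subst e' x y x' y'.
by [].
Qed.

Lemma tau1_edge_id (X : sSet) (x : X 0) (e : edge X x x) :
  e = degen_edge x :> X 1 -> tau1_edge e = @idm (tau1 X) x.
Proof.
move=> /arr_tau1_edge/arr_inj ->; apply/tau1_classP; exact: pcong_degen.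
Qed.

Lemma tau1_edge_comp (X : sSet) (x y z : X 0) (f : edge X x y) (g : edge X y z)
  (h : edge X x z) :
  is_triangle f g h ->
  tau1_edge h = @comp (tau1 X) _ _ _ (tau1_edge g) (tau1_edge f).
Proof.
move=> fgh; rewrite [RHS]tau1_comp_class; apply/tau1_classP/pcong_sym.
exact: pcong_triangle.
Qed.

Lemma face_edge_triangle (X : sSet) n (s : X n) (i j k : 'I_n.+1)
  (ij : (i <= j)%O) (jk : (j <= k)%O) (ik : (i <= k)%O) :
  is_triangle (face_edge s ij) (face_edge s jk) (face_edge s ik).
Proof.
exists (act (triangle_map ij jk) s).
by split; rewrite -act_comp; congr act; apply: omorphism_ext;
  case=> [[|[|t]] ht].
Qed.

Definition tau1_unit_functor (X : sSet) n (s : X n) : functor (ordcat n) (tau1 X).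
Proof.
exists (vertex s : ordcat n -> tau1 X)
  (fun i j (ij : (i <= j)%O) => tau1_edge (face_edge s ij)).
- move=> i; apply: tau1_edge_id => /=.
  rewrite /vertex -act_comp; congr act; apply: omorphism_ext => t /=.
  by rewrite /edge_fun if_same.
- move=> i j k jk ij; apply: tau1_edge_comp; exact: face_edge_triangle.
Defined.

Definition tau1_unit (X : sSet) : smap X (nerve (tau1 X)).
Proof.
exists (@tau1_unit_functor X) => m n f x.
apply: functor_ext => i j ij /=; apply: arr_tau1_edge => /=.
rewrite -act_comp; congr act; apply: omorphism_ext => t /=.
by rewrite /edge_fun; case: ifP.
Defined.

Definition hom_cast (D : category) (a b a' b' : D) (ea : a = a') (eb : b = b')
  (f : hom a b) : hom a' b' :=
  eq_rect a (fun a => hom a b') (eq_rect b (fun b => hom a b) f b' eb) a' ea.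

Lemma arr_hom_cast (D : category) (a b a' b' : D) (ea : a = a') (eb : b = b')
  (f : hom a b) : arr (hom_cast ea eb f) = arr f.
Proof. by subst a' b'. Qed.

Lemma arr_comp (D : category) (a b c a' b' c' : D)
  (f : hom a b) (g : hom b c) (f' : hom a' b') (g' : hom b' c') :
  arr f = arr f' -> arr g = arr g' -> arr (comp g f) = arr (comp g' f').
Proof.
have P (u v : D) (h : hom u v) (u' v' : D) (h' : hom u' v') :
    arr h = arr h' -> exists (eu : u = u') (ev : v = v'), hom_cast eu ev h = h'.
  have Q (k k' : arrow D) : k = k' ->
      exists (eu : projT1 k = projT1 k') (ev : projT1 (projT2 k) = projT1 (projT2 k')),
      hom_cast eu ev (projT2 (projT2 k)) = projT2 (projT2 k').
    by move=> <-; exists erefl, erefl.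
  exact: Q.
move=> /P[ea [eb <-]] /P[eb' [ec <-]]; subst a' b' c'.
by rewrite (Prop_irrelevance eb' erefl).
Qed.

Lemma arr_idm (D : category) (a b : D) : a = b -> arr (idm a) = arr (idm b).
Proof. by move->. Qed.

Lemma arr_fhom (C D : category) (F G : functor C D) (x y x' y' : C)
  (f : hom x y) (f' : hom x' y') :
  F = G -> arr f = arr f' -> arr (fhom F f) = arr (fhom G f').
Proof.
move=> <-; set k := arr f; set k' := arr f' => kk'.
exact: (congr1 (fun k : arrow C => arr (fhom F (projT2 (projT2 k)))) kk').
Qed.

Section Tau1Universal.
Variables (X : sSet) (D : category) (F : smap X (nerve D)).

Let F0 (x : X 0) : D := fob (F 0 x) ord0.

Let F_vertex n (s : X n) (i : 'I_n.+1) : fob (F n s) i = F0 (vertex s i).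
Proof. by rewrite /F0 /vertex smap_nat. Qed.

Let F1 (x y : X 0) (e : edge X x y) : hom (F0 x) (F0 y) :=
  hom_cast (etrans (F_vertex e ord0) (congr1 F0 (edge_src e)))
           (etrans (F_vertex e ord_max) (congr1 F0 (edge_tgt e)))
           (@fhom (ordcat 1) D (F 1 e) ord0 ord_max isT).

Fixpoint tau1_eval (x y : X 0) (p : epath X x y) : hom (F0 x) (F0 y) :=
  match p with
  | pnil _ => idm _
  | pcons _ _ _ e p' => comp (tau1_eval p') (F1 e)
  end.

Let F1_face n (s : X n) (i j : 'I_n.+1) (ij : (i <= j)%O) (x y : X 0)
  (e : edge X x y) :
  e = act (edge_map ij) s :> X 1 ->
  arr (F1 e) = arr (@fhom (ordcat n) D (F n s) i j ij).
Proof.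
move=> es; rewrite arr_hom_cast.
have FE : F 1 e = functor_comp (F n s) (delta_functor (edge_map ij)).
  by rewrite es smap_nat.
rewrite (arr_fhom FE erefl) /=.
by congr (arr (fhom _ _)); exact: bool_irrelevance.
Qed.

Let eval_cat (x y z : X 0) (p : epath X x y) (q : epath X y z) :
  tau1_eval (pcat p q) = comp (tau1_eval q) (tau1_eval p).
Proof. by elim: p q => /= [?|? ? ? e p IHp] q; rewrite ?compm1 ?IHp ?compA. Qed.

Let eval_cong (x y : X 0) (p q : epath X x y) :
  pcong p q -> tau1_eval p = tau1_eval q.
Proof.
elim=> {x y p q} /=.
- move=> x; rewrite comp1m; apply: arr_inj.
  have e : degen_edge x = act (edge_map (lexx (ord0 : 'I_1))) x :> X 1.
    by congr act; apply: omorphism_ext => t /=; rewrite /edge_fun if_same.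
  rewrite (F1_face e) (_ : lexx ord0 = idm (ord0 : ordcat 0)) //.
  by rewrite fhom_id.
- move=> x y z f g h [s [sf sg sh]]; rewrite !comp1m; apply: arr_inj.
  have ef : f = act (@edge_map 2 ord0 (@Ordinal 3 1 isT) isT) s :> X 1.
    by rewrite -sf; congr act; apply: omorphism_ext => -[[|[|t]] ht]; apply: val_inj.
  have eg : g = act (@edge_map 2 (@Ordinal 3 1 isT) ord_max isT) s :> X 1.
    by rewrite -sg; congr act; apply: omorphism_ext => -[[|[|t]] ht]; apply: val_inj.
  have eh : h = act (@edge_map 2 ord0 ord_max isT) s :> X 1.
    by rewrite -sh; congr act; apply: omorphism_ext => -[[|[|t]] ht]; apply: val_inj.
  rewrite (arr_comp (F1_face ef) (F1_face eg)) (F1_face eh) -fhom_comp.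
  by congr (arr (fhom _ _)); exact: bool_irrelevance.
- by [].
- by move=> x y p q _ ->.
- by move=> x y p q r _ -> _ ->.
- by move=> x y z p p' q q' _ pp' _ qq'; rewrite !eval_cat pp' qq'.
Qed.

Definition tau1_lift : functor (tau1 X) D.
Proof.
exists (F0 : tau1 X -> D)
  (fun x y (f : @hom (tau1 X) x y) => tau1_eval (projT1 (cid (svalP f)))).
- move=> x; case: cid => /= p e.
  apply/esym/(eval_cong (p := pnil x))/tau1_classP; exact: eq_exist.
- move=> x y z g f.
  have lift_class (u v : X 0) (k : tau1_hom u v) p : k = tau1_class p ->
      tau1_eval (projT1 (cid (svalP k))) = tau1_eval p.
    move=> ->; case: cid => /= q e; apply/esym/eval_cong/tau1_classP.
    exact: eq_exist.
  have [p fp] := tau1_class_surj f; have [q gq] := tau1_class_surj g.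
  rewrite (lift_class _ _ _ _ fp) (lift_class _ _ _ _ gq) -eval_cat.
  by apply: lift_class; rewrite fp gq /= tau1_comp_class.
Defined.

Lemma tau1_lift_class (x y : X 0) (p : epath X x y) :
  @fhom _ _ tau1_lift x y (tau1_class p) = tau1_eval p.
Proof.
rewrite /=; case: cid => /= q e; apply/esym/eval_cong/tau1_classP.
exact: eq_exist.
Qed.

(* This exhibits tau1 as left adjoint to the nerve, with unit tau1_unit. *)
Theorem tau1_universal :
  exists! G : functor (tau1 X) D, smap_comp (nerve_map G) (tau1_unit X) = F.
Proof.
exists tau1_lift; split=> [|G GF].
  apply: smap_ext => n s; apply: functor_ext => i j ij.
  have -> : fhom (smap_comp (nerve_map tau1_lift) (tau1_unit X) n s) ij
          = @fhom _ _ tau1_lift _ _ (tau1_edge (face_edge s ij)) by [].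
  by rewrite tau1_lift_class /= comp1m; exact: F1_face.
have G0 x : F0 x = G x.
  rewrite /F0 -GF /=; congr (fob G _).
  by rewrite /vertex -[RHS]act_id; congr act; apply: omorphism_ext => t; rewrite [RHS]ord1.
have G1 x y (e : edge X x y) : arr (fhom G (tau1_edge e)) = arr (F1 e).
  rewrite arr_hom_cast -GF /=; apply: arr_fhom => //; apply: arr_tau1_edge => /=.
  rewrite -[LHS]act_id; congr act; apply: omorphism_ext => -[[|[|t]] ht] //=;
    exact: val_inj.
apply: functor_ext => x y f; have [p ->] := tau1_class_surj f.
rewrite tau1_lift_class; elim: p {f} => /= [z|u v w e p IHp].
  rewrite (arr_idm (G0 z)) -fhom_id; exact: erefl.
rewrite (arr_comp (esym (G1 _ _ e)) IHp) -fhom_comp.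
by congr (arr (fhom G _)); exact: tau1_comp_class.
Qed.

End Tau1Universal.

Definition is_equivalence (X : sSet) (e : X 1) : Prop :=
  is_iso (tau1_edge (Edge (erefl (src e)) (erefl (tgt e)))).

(* The maximal Kan subcomplex, when X is a quasicategory. *)
Definition core (X : sSet) : ssubset X.
Proof.
exists (fun n (x : X n) => forall e : delta 1 n, is_equivalence (act e x)).
by move=> m n f x xE e; rewrite -act_comp; exact: xE.
Defined.

Fact vertex_in_boundary n (i : 'I_n.+2) :
  smem (boundary n.+1) (vertex_map i : simplex n.+1 0).
Proof.
exists (if i == ord0 then ord_max else ord0) => _ /=.
by case: ifP => [/eqP ->|/negbT].
Qed.

Definition boundary_vertex n (i : 'I_n.+2) : boundary n.+1 0 :=
  exist _ (vertex_map i : simplex n.+1 0) (vertex_in_boundary i).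

(* Joyal's definition by filling of spheres.  It is the join-adjoint form of the
   coslice (resp. slice) projection at x being a trivial fibration. *)
Definition is_initial (X : sSet) (x : X 0) : Prop :=
  forall n (s : smap (boundary n.+1) X), s 0 (boundary_vertex ord0) = x ->
  exists t : smap (simplex n.+1) X, smap_comp t (ssub_incl (boundary n.+1)) = s.

Definition is_terminal (X : sSet) (x : X 0) : Prop :=
  forall n (s : smap (boundary n.+1) X), s 0 (boundary_vertex ord_max) = x ->
  exists t : smap (simplex n.+1) X, smap_comp t (ssub_incl (boundary n.+1)) = s.

Definition is_zero_object (X : sSet) (x : X 0) : Prop :=
  is_initial x /\ is_terminal x.

Definition cut_part n (c : {omorphism 'I_n.+1 -> bool}) (b : bool) :
  ssubset (simplex n).
Proof.
exists (fun m (g : simplex n m) => forall i, c (g i) = b).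
by move=> m l f g gc i; exact: gc.
Defined.

Definition cut_part_map m n (f : delta m n) (c : {omorphism 'I_n.+1 -> bool})
  (b : bool) : smap (cut_part (c \o f) b) (cut_part c b).
Proof.
exists (fun l (g : cut_part (c \o f) b l) =>
          exist _ (delta_comp f (sval g)) (svalP g) : cut_part c b l).
by move=> l k h g; apply: eq_exist; exact: omorphism_ext.
Defined.

(* An n-simplex of the join of X and Y is a decomposition of [n] into an initial
   and a final segment (either of which may be empty), together with a simplex
   of X on the initial segment and a simplex of Y on the final one. *)
Record join_simplex (X Y : sSet) (n : nat) := JoinSimplex {
  join_cut : {omorphism 'I_n.+1 -> bool};
  join_l : smap (cut_part join_cut false) X;
  join_r : smap (cut_part join_cut true) Y
}.

Lemma join_simplex_ext X Y n (a b : join_simplex X Y n) :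
  join_cut a =1 join_cut b ->
  (forall m (g : delta m n) ga gb,
     join_l a m (exist _ g ga : cut_part (join_cut a) false m) =
     join_l b m (exist _ g gb : cut_part (join_cut b) false m)) ->
  (forall m (g : delta m n) ga gb,
     join_r a m (exist _ g ga : cut_part (join_cut a) true m) =
     join_r b m (exist _ g gb : cut_part (join_cut b) true m)) ->
  a = b.
Proof.
case: a b => [c l r] [c' l' r'] /= cc' ll' rr'.
have {}cc' : c = c' by apply: omorphism_ext.
subst c'; congr JoinSimplex; apply: smap_ext => m [g gc].
- exact: ll'.
- exact: rr'.
Qed.

Definition join (X Y : sSet) : sSet.
Proof.
exists (join_simplex X Y)
  (fun m n f a => JoinSimplex
     (smap_comp (join_l a) (cut_part_map f (join_cut a) false))
     (smap_comp (join_r a) (cut_part_map f (join_cut a) true))).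
- move=> n x; apply: join_simplex_ext => //= m g ga gb;
    congr smap_fun; apply: eq_exist; exact: omorphism_ext.
- move=> l m n f g x; apply: join_simplex_ext => //= k h ha hb;
    congr smap_fun; apply: eq_exist; exact: omorphism_ext.
Defined.

Definition const_cut n (b : bool) : {omorphism 'I_n.+1 -> bool} :=
  HB.pack (fun _ : 'I_n.+1 => b)
    (Order.isOrderMorphism.Build _ _ _ _ (fun _ => b) (fun _ _ _ => lexx b)).

Definition empty_smap n (X : sSet) : smap (cut_part (const_cut n false) true) X.
Proof.
unshelve eexists; first by move=> m [g /(_ ord0)].
by move=> l m f [g gc]; have := gc ord0.
Defined.

Definition simplex_smap (X : sSet) n (x : X n) (A : ssubset (simplex n)) :
  smap A X.
Proof.
exists (fun m (g : A m) => act (sval g : delta m n) x) => l m f g.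
by rewrite -act_comp.
Defined.

Definition join_inl (X Y : sSet) : smap X (join X Y).
Proof.
exists (fun n x => JoinSimplex
          (simplex_smap x (cut_part (const_cut n false) false)) (empty_smap n Y)
        : join X Y n) => m n f x.
apply: join_simplex_ext => //= [l g ga gb|l g ga]; last by have := ga ord0.
by rewrite act_comp.
Defined.

Definition join_map (X Y Z : sSet) (h : smap Y Z) : smap (join X Y) (join X Z).
Proof.
exists (fun n (a : join X Y n) =>
  JoinSimplex (join_l a) (smap_comp h (join_r a)) : join X Z n) => m n f a.
by apply: join_simplex_ext => //= l g ga gb;
  rewrite (Prop_irrelevance ga gb).
Defined.

Definition const_smap (S X : sSet) (x : X 0) : smap S X.
Proof.
exists (fun n _ => act (degen_map n) x) => m n f _.
by rewrite -act_comp; congr act; exact: omorphism_ext.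
Defined.

Fact edge_cut_homo : {homo (fun t : 'I_2 => t != ord0) : x y / (x <= y)%O}.
Proof. by move=> [[|[|x]] hx] [[|[|y]] hy]. Qed.

Definition edge_cut : {omorphism 'I_2 -> bool} :=
  HB.pack (fun t : 'I_2 => t != ord0)
    (Order.isOrderMorphism.Build _ _ _ _ _ edge_cut_homo).

(* The edge of the join from a vertex of X to a vertex of Y. *)
Definition join_edge (X Y : sSet) (x : X 0) (y : Y 0) : join X Y 1 :=
  @JoinSimplex X Y 1 edge_cut (const_smap _ x) (const_smap _ y).

(* The coslice of X under p: its n-simplices are the maps from the join of K and
   the n-simplex to X which restrict to p on K. *)
Definition coslice (K X : sSet) (p : smap K X) : sSet.
Proof.
unshelve refine (@SSet
  (fun n => {q : smap (join K (simplex n)) X | smap_comp q (join_inl _ _) = p})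
  (fun m n f q => exist _ (smap_comp (sval q) (join_map K (simplex_map f))) _)
  _ _).
- rewrite -[RHS](svalP q); apply: smap_ext => l x /=; congr smap_fun.
  by apply: join_simplex_ext => //= k g ga; have := ga ord0.
- move=> n [q qp] /=; apply: eq_exist; apply: smap_ext => l x /=.
  congr smap_fun; apply: join_simplex_ext => //= k g ga gb.
  + by rewrite (Prop_irrelevance ga gb).
  + by rewrite (Prop_irrelevance ga gb); exact: omorphism_ext.
- move=> l m n f g [q qp] /=; apply: eq_exist; apply: smap_ext => k x /=.
  congr smap_fun; apply: join_simplex_ext => //= j h ha hb.
  + by rewrite (Prop_irrelevance ha hb).
  + by rewrite (Prop_irrelevance ha hb); exact: omorphism_ext.
Defined.

(* A vertex of the coslice is a cocone on p. *)
Definition is_colimit (K X : sSet) (p : smap K X) (q : coslice p 0) : Prop :=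
  is_initial q.

Definition span_shape : sSet := @horn 2 ord0.

Definition ord3_1 : 'I_3 := @Ordinal 3 1 isT.
Definition ord3_2 : 'I_3 := ord_max.

Fact span_edge1_subproof :
  smem (@horn 2 ord0) (@edge_map 2 ord0 ord3_1 isT : simplex 2 1).
Proof. by exists ord3_2 => // -[[|[|t]] ht]. Qed.

Definition span_edge1 : span_shape 1 := exist _ _ span_edge1_subproof.

Fact span_edge2_subproof :
  smem (@horn 2 ord0) (@edge_map 2 ord0 ord3_2 isT : simplex 2 1).
Proof. by exists ord3_1 => // -[[|[|t]] ht]. Qed.

Definition span_edge2 : span_shape 1 := exist _ _ span_edge2_subproof.

Fact span_vertex2_subproof :
  smem (@horn 2 ord0) (vertex_map ord3_2 : simplex 2 0).
Proof. by exists ord3_1. Qed.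

Definition span_vertex2 : span_shape 0 := exist _ _ span_vertex2_subproof.

(* g is a pushout of f along u: some pushout square has the form
          u
      a -----> c
    f |        | g
      v        v
      b -----> d                                                             *)
Definition is_pushout (X : sSet) (a b c d : X 0)
    (f : edge X a b) (u : edge X a c) (g : edge X c d) : Prop :=
  exists (p : smap span_shape X) (q : coslice p 0),
    [/\ p 1 span_edge1 = f, p 1 span_edge2 = u, is_colimit q
      & sval q 1 (join_edge span_vertex2 (delta_id 0 : simplex 0 0)) = g].

(*        t
      P -----> B
    l |        | r
      v        v
      C -----> E
          b                                                                  *)
Definition is_pullback (P B C E : sSet) (t : smap P B) (l : smap P C)
    (r : smap B E) (b : smap C E) : Prop :=
  smap_comp r t = smap_comp b l /\
  forall (T : sSet) (x : smap T B) (y : smap T C),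
    smap_comp r x = smap_comp b y ->
    exists! z : smap T P, smap_comp t z = x /\ smap_comp l z = y.

Definition has_zero_object (C : sSet) : Prop := exists z : C 0, is_zero_object z.

Definition zero_morphisms_cofibrations (C : sSet) (D : ssubset C) : Prop :=
  forall z a : C 0, is_zero_object z ->
  forall f : edge C z a, smem D (f : C 1).

Definition has_pushouts_of_cofibrations (C : sSet) (D : ssubset C) : Prop :=
  forall (a b c : C 0) (f : edge C a b) (u : edge C a c), smem D (f : C 1) ->
  exists (d : C 0) (g : edge C c d), is_pushout f u g.

Definition pushouts_are_cofibrations (C : sSet) (D : ssubset C) : Prop :=
  forall (a b c d : C 0) (f : edge C a b) (u : edge C a c) (g : edge C c d),
  smem D (f : C 1) -> is_pushout f u g -> smem D (g : C 1).

Record is_waldhausen_quasicategory (C : sSet) (coC : ssubset C) : Prop := {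
  wald_quasicategory : is_quasicategory C;
  wald_has_zero : has_zero_object C;
  wald_sub_quasicategory : is_quasicategory coC;
  wald_one_full : one_full coC;
  wald_equivalences : forall f : C 1, is_equivalence f -> smem coC f;
  wald_zero : zero_morphisms_cofibrations coC;
  wald_pushout_exists : has_pushouts_of_cofibrations coC;
  wald_pushout : pushouts_are_cofibrations coC
}.

Definition is_subcategory_of_quasicategory (C : sSet) (D : ssubset C) : Prop :=
  exists (A : subcategory (tau1 C)) (l : smap D (nerve A)),
    is_pullback (ssub_incl D) l (tau1_unit C) (nerve_map (subcat_incl A)).

Record is_barwick_waldhausen (C : sSet) (D : ssubset C) : Prop := {
  barwick_quasicategory : is_quasicategory C;
  barwick_core : ssubset_incl (core C) D;
  barwick_subcategory : is_subcategory_of_quasicategory D;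
  barwick_has_zero : has_zero_object C;
  barwick_zero : zero_morphisms_cofibrations D;
  barwick_pushout_exists : has_pushouts_of_cofibrations D;
  barwick_pushout : pushouts_are_cofibrations D
}.

(* Main.v *)
From HB Require Import structures.
From mathcomp Require Import all_boot all_order.
From mathcomp Require Import boolp zify.
Import Order.TTheory.
Require Import Defs.

(** Both notions ask for the same zero objects and the same pushouts; they
    differ in how they say that the cofibrations D form a subcategory of C.

    If D is pulled back from a subcategory A of the homotopy category, a simplex
    of C lies in D exactly when the classes of its edges lie in A
    ([pullback_mem]).  Hence D is 1-full, and it has inner fillers: fill in C;
    the only edge of the filler that can be missing from an inner horn is the
    long edge of a triangle, and its class is a composite of classes in A.

    Conversely, let A consist of the classes of the edges in D; it is closed
    under composition because triangles can be filled inside D.  The point is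
    that an edge e of C whose class is that of an edge e' in D must lie in D.
    Filling horns inside D cannot show this: it yields some composite, not all of
    them.  It follows from the stability of cofibrations under pushout.  Equality
    of the classes means that some triangle has the edges e', a degenerate edge,
    and e ([tau1_edge_homotopic], after Boardman and Vogt), and this triangle is
    one half of a square that exhibits e as a pushout of e' along a degenerate
    edge ([homotopic_pushout]).

    That this square, whose vertices are called a, b, c, d, is a pushout means
    that a map defined on the join of the span b <- a -> c with the boundary of
    an N-simplex, and given by the square at vertex 0 of that simplex, extends to
    the join with the whole N-simplex P.  Both joins are subcomplexes of the
    simplex on a < b < c < P.  The faces to add are P and bP, then aP and abP,
    then cP and acP ([cocone_extends]).  The middle pair is attached along an
    inner horn, the two others along an outer horn whose first edge (from b to
    vertex 0 of P, from a to c) is degenerate.  Such outer horns have fillers in a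
    quasicategory ([outer_horn_extends]): this is the case of a degenerate first
    edge in Joyal's theorem on special outer horns, and it is obtained from inner
    horns by adding two auxiliary vertices.

    Throughout, a map from a subcomplex of an M-simplex to C is a function on all
    simplices of the M-simplex which is only required to be natural on those
    whose set of vertices belongs to a given family ([simplicial_on]).  Extension
    problems then become statements about families of finite sets, and
    [toggle_extends] turns most of them into a check of membership of a few
    vertices. *)

Set Implicit Arguments.
Unset Strict Implicit.
Unset Printing Implicit Defensive.

(** * Partial maps out of simplices *)

Definition monotone m n (f : 'I_m.+1 -> 'I_n.+1) (fP : {homo f : i j / (i <= j)%O}) :
    delta m n :=
  HB.pack f (Order.isOrderMorphism.Build _ _ _ _ _ fP).

Definition image_set m M (f : delta m M) : {set 'I_M.+1} := [set f i | i : 'I_m.+1].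

Lemma mem_image_set m M (f : delta m M) i : f i \in image_set f.
Proof. exact: imset_f. Qed.

Lemma image_setP m M (f : delta m M) (T : {set 'I_M.+1}) :
  reflect (forall i, f i \in T) (image_set f \subset T).
Proof.
apply: (iffP subsetP) => [fT i|fT x /imsetP[i _ ->]]; last exact: fT.
exact/fT/mem_image_set.
Qed.

Lemma image_set_comp k m M (f : delta m M) (h : delta k m) :
  image_set (delta_comp f h) = f @: image_set h.
Proof. by rewrite /image_set -imset_comp. Qed.

Lemma image_set_sub k m M (f : delta m M) (h : delta k m) :
  image_set (delta_comp f h) \subset image_set f.
Proof. by apply/image_setP => i /=; exact: mem_image_set. Qed.

Lemma delta_compA j k l m (f : delta l m) (g : delta k l) (h : delta j k) :
  delta_comp f (delta_comp g h) = delta_comp (delta_comp f g) h.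
Proof. exact: omorphism_ext. Qed.

Definition face_family M := {set 'I_M.+1} -> bool.

Definition down_closed M (A : face_family M) :=
  forall S T : {set 'I_M.+1}, S \subset T -> A T -> A S.

Lemma down_closedU M (A B : face_family M) :
  down_closed A -> down_closed B -> down_closed (fun T => A T || B T).
Proof.
by move=> Acl Bcl S T ST /orP[/(Acl _ _ ST) ->|/(Bcl _ _ ST) ->]; rewrite ?orbT.
Qed.

Lemma down_closedI M (A B : face_family M) :
  down_closed A -> down_closed B -> down_closed (fun T => A T && B T).
Proof. by move=> Acl Bcl S T ST /andP[/(Acl _ _ ST) -> /(Bcl _ _ ST) ->]. Qed.

Definition avoids M (v : 'I_M.+1) : face_family M := fun T => v \notin T.

Lemma avoids_closed M (v : 'I_M.+1) : down_closed (avoids v).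
Proof. by move=> S T /subsetP ST; apply: contra => /ST. Qed.

Lemma avoidsP M (v : 'I_M.+1) m (f : delta m M) :
  reflect (forall y, f y != v) (avoids v (image_set f)).
Proof.
apply: (iffP idP) => [vf y|fv]; first by apply: contraNneq vf => <-; exact: mem_image_set.
by apply/imsetP => -[y _ /esym/eqP]; apply/negP.
Qed.

(** The function is defined on all simplices of the M-simplex, with arbitrary
    values outside the subcomplex of interest; naturality is a separate property,
    relative to a family of vertex sets.  This avoids carrying membership proofs
    through extension arguments. *)
Definition total_map M (C : sSet) := forall m, delta m M -> C m.

Definition simplicial_on M (C : sSet) (A : face_family M) (a : total_map M C) :=
  forall k m (h : delta k m) (f : delta m M),
  A (image_set f) -> a k (delta_comp f h) = act h (a m f).

Definition agree_on M (C : sSet) (A : face_family M) (b a : total_map M C) :=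
  forall m (f : delta m M), A (image_set f) -> b m f = a m f.

Definition extends M (C : sSet) (A B : face_family M) (a : total_map M C) :=
  exists b : total_map M C, simplicial_on B b /\ agree_on A b a.

Lemma simplicial_on_sub M C (A B : face_family M) (a : total_map M C) :
  (forall T, A T -> B T) -> simplicial_on B a -> simplicial_on A a.
Proof. by move=> AB aP k m h f /AB; exact: aP. Qed.

Lemma extends_refl M C (A B : face_family M) (a : total_map M C) :
  (forall T, B T -> A T) -> simplicial_on A a -> extends A B a.
Proof. by move=> BA aP; exists a; split=> //; exact: simplicial_on_sub aP. Qed.

Lemma simplicial_on_pull M N C (B : face_family N) (p : delta M N) (b : total_map N C)
    (A : face_family M) :
  (forall T, A T -> B (p @: T)) -> simplicial_on B b ->
  simplicial_on A (fun m f => b m (delta_comp p f)).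
Proof.
move=> AB bP k m h f Af; rewrite delta_compA bP //.
by rewrite image_set_comp; exact: AB.
Qed.

(** Neither map needs to be natural beyond its own family: a restriction of a
    simplex of A is in A, and one of a simplex of B that falls into A has the same
    value under both maps. *)
Lemma glue M C (A B : face_family M) (a b : total_map M C) :
  down_closed A -> down_closed B -> simplicial_on A a -> simplicial_on B b ->
  (forall m f, A (image_set f) -> B (image_set f) -> a m f = b m f) ->
  exists c : total_map M C,
    [/\ simplicial_on (fun T => A T || B T) c, agree_on A c a & agree_on B c b].
Proof.
move=> Acl Bcl aP bP ab.
exists (fun m f => if A (image_set f) then a m f else b m f); split.
- move=> k m h f /orP ABf; have fh := image_set_sub f h.
  have [Af|Af] := boolP (A (image_set f)); first by rewrite (Acl _ _ fh Af) aP.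
  have Bf : B (image_set f) by case: ABf => // Af'; rewrite Af' in Af.
  rewrite -bP //; case: ifPn => // Afh; apply: ab => //; exact: Bcl Bf.
- by move=> m f ->.
- by move=> m f Bf; case: ifPn => // Af; apply: ab.
Qed.

Lemma extends_trans M C (A B D : face_family M) (a : total_map M C) :
  (forall T, A T -> B T) -> extends A B a ->
  (forall b, simplicial_on B b -> agree_on A b a -> extends B D b) -> extends A D a.
Proof.
move=> AB [b [bP ba]] /(_ b bP ba)[d [dP db]]; exists d; split=> // m f Af.
by rewrite db ?ba //; exact: AB.
Qed.

Definition horn_family n (k : 'I_n.+1) : face_family n := fun T => ~~ (~: [set k] \subset T).

Lemma horn_familyP n (k : 'I_n.+1) m (f : delta m n) :
  reflect (smem (horn k) (f : simplex n m)) (horn_family k (image_set f)).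
Proof.
apply: (iffP subsetPn) => [[j jk fj]|[j jk fj]]; exists j.
- by rewrite !inE in jk.
- by move=> i; apply: contraNneq fj => <-; exact: mem_image_set.
- by rewrite !inE.
- by apply/imsetP => -[i _ /esym/eqP]; apply/negP.
Qed.

Lemma inner_horn_extends C n (k : 'I_n.+1) (a : total_map n C) :
  is_quasicategory C -> (0 < k < n)%N ->
  simplicial_on (horn_family k) a -> extends (horn_family k) predT a.
Proof.
move=> hC kP aP.
unshelve epose (h := @SMap (horn k) C (fun m (f : horn k m) => a m (sval f)) _).
  by move=> l m h [f fk] /=; apply: aP; exact/horn_familyP.
have [s sh] := hC n k kP h; exists (fun m f => s m f); split.
  by move=> l m g f _; rewrite -smap_nat.
move=> m f /horn_familyP fk.
exact: (congr1 (fun u : smap (horn k) C => u m (exist _ f fk)) sh).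
Qed.

(** Order-preserving enumeration of T together with a retraction, so that a cell
    on T can be defined on simplices of the whole M-simplex.  A vertex outside T is
    sent to the position of the last element of T before it, or to 0. *)
Lemma face_retract M (T : {set 'I_M.+1}) : T != set0 ->
  exists n (i : delta n M) (p : delta M n),
    image_set i = T /\ forall x, p (i x) = x.
Proof.
move=> /set0Pn[t tT]; have T0 : (0 < #|T|)%N by rewrite (cardD1 t) tT.
have [n nT] : exists n, #|T| = n.+1 by exists #|T|.-1; rewrite prednK.
exists n.
pose i0 (x : 'I_n.+1) : 'I_M.+1 := @Order.enum_val _ _ (mem T) (cast_ord (esym nT) x).
have i0le : {mono i0 : x y / (x <= y)%O}.
  by move=> x y; rewrite /i0 Order.le_enum_val //; exact: le_total.
have i0T x : i0 x \in T by exact: (@Order.enum_valP _ _ (mem T)).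
have i0im : [set i0 x | x : 'I_n.+1] = T.
  apply/eqP; rewrite eqEcard card_imset; last first.
    by move=> x y /eqP; rewrite eq_le !i0le -eq_le => /eqP.
  rewrite card_ord nT leqnn andbT.
  by apply/subsetP => y /imsetP[x _ ->].
pose p0 (y : 'I_M.+1) : 'I_n.+1 := inord #|[set t in T | (t <= y)%O]|.-1.
have p0b y : (#|[set t in T | (t <= y)%O]|.-1 < n.+1)%N.
  rewrite ltnS -[n]/n.+1.-1 -nT -!subn1 leq_sub2r //; apply: subset_leq_card.
  by apply/subsetP => z; rewrite inE => /andP[].
have p0le : {homo p0 : x y / (x <= y)%O}.
  move=> x y xy; rewrite leEord !inordK // -!subn1 leq_sub2r //.
  apply: subset_leq_card; apply/subsetP => z; rewrite !inE => /andP[->] /=.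
  by move=> zx; exact: le_trans xy.
exists (monotone (fun x y xy => etrans (i0le x y) xy)), (monotone p0le); split=> //= x.
apply: val_inj; rewrite /= inordK //.
have -> : [set z in T | (z <= i0 x)%O] = i0 @: [set z : 'I_n.+1 | (z <= x)%O].
  apply/setP => z; rewrite inE -{1}i0im; apply/andP/imsetP.
    by move=> [/imsetP[w _ ->]]; rewrite i0le => wx; exists w; rewrite ?inE.
  move=> [w]; rewrite inE => wx ->; rewrite i0le; split=> //.
  by apply/imsetP; exists w.
rewrite card_imset; last by move=> u v /eqP; rewrite eq_le !i0le -eq_le => /eqP.
have -> : [set z : 'I_n.+1 | (z <= x)%O] = [set widen_ord (ltn_ord x) z | z : 'I_x.+1].
  apply/setP => z; rewrite inE; apply/idP/imsetP => [zx|[w _ ->]].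
    by exists (Ordinal (zx : (z < x.+1)%N)) => //; exact: val_inj.
  by rewrite leEord /= -ltnS.
rewrite card_imset ?card_ord //.
by move=> u v /(congr1 val) /= ?; exact: val_inj.
Qed.

(** * Attaching cells along horns *)

(** Attaches the face T together with its facet opposite to v, when all other
    facets of T are present.  The last premise asks for a filler of the horn which
    the map induces on T; whether it is inner or outer depends on the position of v
    in T. *)
Lemma cell_extends M C (A : face_family M) (T : {set 'I_M.+1}) v (a : total_map M C) :
  down_closed A -> v \in T -> ~~ A (T :\ v) ->
  (forall w, w \in T -> w != v -> A (T :\ w)) -> simplicial_on A a ->
  (forall n (i : delta n M) k, image_set i = T -> injective i -> i k = v ->
     let ai := fun m f => a m (delta_comp i f) in
     simplicial_on (horn_family k) ai -> extends (horn_family k) predT ai) ->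
  extends A (fun S => A S || (S \subset T)) a.
Proof.
move=> Acl vT AT AD aP fillP.
have [|n [i [p [iT pi]]]] := @face_retract M T; first by apply/set0Pn; exists v.
have i_inj : injective i by apply: can_inj pi.
have ip t : t \in T -> i (p t) = t.
  by rewrite -iT => /imsetP[x _ ->]; rewrite pi.
have [k ik] : exists k, i k = v.
  by have := vT; rewrite -iT => /imsetP[k _ ->]; exists k.
have hornA S : horn_family k S -> A (i @: S).
  move=> /subsetPn[j]; rewrite !inE => jk jS.
  apply: (@Acl _ (T :\ i j)).
    apply/subsetP => _ /imsetP[x xS ->]; rewrite !inE -iT mem_image_set andbT.
    by apply: contraNneq jS => /i_inj <-.
  by apply: AD; rewrite -?iT ?mem_image_set // -ik (inj_eq i_inj).
have [|b [bP ba]] := fillP n i k iT i_inj ik.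
  exact: simplicial_on_pull aP.
have Tcl : down_closed (fun S : {set 'I_M.+1} => S \subset T).
  by move=> S S' SS' /(subset_trans SS').
have bpP : simplicial_on (fun S : {set 'I_M.+1} => S \subset T)
    (fun m f => b m (delta_comp p f)).
  exact: simplicial_on_pull bP.
have [|c [cP ca _]] := glue Acl Tcl aP bpP; last by exists c.
move=> m f Af fT; rewrite ba.
  by congr (a m); apply: omorphism_ext => x /=; rewrite ip // (image_setP _ _ fT).
rewrite image_set_comp; apply: contra AT => /subsetP kp; apply: Acl Af.
apply/subsetP => t; rewrite !inE => /andP[tv tT].
have /kp/imsetP[u uf ptu] : p t \in ~: [set k].
  by rewrite !inE; apply: contraNneq tv => ptk; rewrite -(ip t) // ptk ik.
by rewrite -(ip t) // ptu ip // (subsetP fT).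
Qed.

Definition inner_vertex M (v : 'I_M.+1) (T : {set 'I_M.+1}) :=
  [exists x in T, (x < v)%N] && [exists y in T, (v < y)%N].

Lemma homo_lt_reflect m M (i : delta m M) x y : (i x < i y)%N -> (x < y)%N.
Proof.
by rewrite !ltnNge; apply: contra => yx; exact: (omorph_le i (yx : (y <= x)%O)).
Qed.

Lemma inner_cell_extends M C (A : face_family M) (T : {set 'I_M.+1}) v (a : total_map M C) :
  is_quasicategory C -> down_closed A -> v \in T -> inner_vertex v T -> ~~ A (T :\ v) ->
  (forall w, w \in T -> w != v -> A (T :\ w)) -> simplicial_on A a ->
  extends A (fun S => A S || (S \subset T)) a.
Proof.
move=> hC Acl vT vin AT AD aP; apply: cell_extends AT AD aP _ => // n i k iT _ ik ai.
apply: inner_horn_extends => //; move: vin; rewrite /inner_vertex -iT -ik.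
move=> /andP[/existsP[_ /andP[/imsetP[x _ ->]] /homo_lt_reflect xk]].
move=> /existsP[_ /andP[/imsetP[y _ ->]] /homo_lt_reflect ky].
by rewrite (leq_ltn_trans _ xk) //= -ltnS (leq_ltn_trans ky).
Qed.

(** The faces to be added come in pairs T, T minus v with v interior to T.  They
    can be attached in the order of increasing size: removing from T a vertex other
    than v gives a face that contains v and is smaller, hence is already there, and
    the facet opposite to v belongs to no other pair. *)
Lemma toggle_extends M C (v : 'I_M.+1) (A B : face_family M) (a : total_map M C) :
  is_quasicategory C -> down_closed A -> down_closed B -> (forall T, A T -> B T) ->
  (forall T, B T -> ~~ A T -> [/\ B (v |: T), ~~ A (T :\ v) & inner_vertex v T]) ->
  simplicial_on A a -> extends A B a.
Proof.
move=> hC + Bcl; have [n] := ubnP #|[set T | B T && ~~ A T]|.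
elim: n A a => // n IHn A a An Acl AB ABv aP.
have [/existsP[T0 /andP[BT0 AT0]]|/existsPn noT] := boolP [exists T, B T && ~~ A T];
  last first.
  apply: extends_refl aP => T BT; have := noT T; rewrite BT negbK; exact.
pose cand := fun T : {set 'I_M.+1} => [&& v \in T, B T & ~~ A T].
have candT0 : cand (v |: T0).
  have [BvT0 _ _] := ABv _ BT0 AT0; rewrite /cand setU11 BvT0 /=.
  by apply: contra AT0; apply: Acl; exact: subsetUr.
have [T /and3P[vT BT AT] Tmin] :=
  @arg_minnP _ (v |: T0) cand (fun T : {set 'I_M.+1} => #|T|) candT0.
have [_ ATv vin] := ABv _ BT AT.
have AD w : w \in T -> w != v -> A (T :\ w).
  move=> wT wv; apply: contraT => ATw.
  have /Tmin : cand (T :\ w).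
    by rewrite /cand !inE eq_sym wv vT ATw (Bcl _ _ (subsetDl _ _) BT).
  by rewrite (cardsD1 w T) wT ltnn.
apply: (extends_trans _ (inner_cell_extends hC Acl vT vin ATv AD aP)).
  by move=> S ->.
move=> b bP _; apply: IHn bP.
- rewrite ltnS in An; apply: leq_trans An; apply/proper_card/properP; split.
    apply/subsetP => S; rewrite !inE negb_or => /and3P[-> -> //].
  by exists T; rewrite !inE ?BT ?AT //= subxx orbT.
- move=> S S' SS' /orP[/(Acl _ _ SS') -> //|/(subset_trans SS') ->].
  by rewrite orbT.
- by move=> S /orP[/AB //|ST]; exact: Bcl BT.
- move=> S BS; rewrite !negb_or => /andP[AS ST].
  have [-> -> ->] := ABv _ BS AS; split=> //=.
  apply: contra ST => /subsetP STv; apply/subsetP => x xS.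
  have [->//|xv] := eqVneq x v; apply: STv; rewrite !inE xv; exact: xS.
Qed.

(** A map defined on the whole M-simplex is a simplex of C: evaluate at the
    identity. *)
Lemma extends_simplex M C (A : face_family M) (a : total_map M C) :
  extends A predT a -> exists s : C M, forall m f, A (image_set f) -> act f s = a m f.
Proof.
move=> [b [bP ba]]; exists (b M (delta_id M)) => m f Af.
by rewrite -bP // -ba //; congr b; exact: omorphism_ext.
Qed.

(** * Outer horns with degenerate first edge *)

Definition degenerate_on M (C : sSet) (T : {set 'I_M.+1}) (x : C 0) (a : total_map M C) :=
  forall m (f : delta m M), image_set f \subset T -> a m f = act (degen_map m) x.

(** The case of a degenerate first edge in Joyal's theorem on special outer horns.
    The horn has vertices 0, 1 and a nonempty tail F; it misses the faces
    1F and 01F.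

    The ambient simplex has vertices v0 < v1 < v2 < v3 < F, where v0 and v2 are
    copies of 0, v1 and v3 copies of 1.  All edges among the first four vertices are
    degenerate, so that v1 -> v2 is an inverse of the given edge v2 -> v3, and
    v0 -> v1 an inverse of v1 -> v2.  Write S for a proper subset of F.

    The horn determines the map on the faces without v1 that do not contain v3 F
    (through [p0]), on the faces without v0 and v2 that do not contain F (through
    [p1]), and on the faces without any vertex of F, where it is constant.  Inner
    horns at v3 produce the faces v1 v2 S.  Inner horns at v2 transport v2 F, which
    is given, to v1 F and to v0 v1 F, and also produce v0 v1 v3 S.  The face v3 F can
    now be chosen equal to v1 F, with degenerate v1 v3 F (through [q]).  Inner horns
    at v1 finally produce v0 v3 F, which fills the given horn because its facets
    v0 v3 S and v0 F come from the horn unchanged. *)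
Section OuterHorn.
Variables (C : sSet) (n : nat) (x : C 0) (h : total_map n.+2 C).
Hypothesis hC : is_quasicategory C.
Hypothesis hP : simplicial_on (horn_family (ord0 : 'I_n.+3)) h.

Local Notation V := 'I_n.+4.+1.
Let v0 : V := @Ordinal n.+4.+1 0 isT.
Let v1 : V := @Ordinal n.+4.+1 1 isT.
Let v2 : V := @Ordinal n.+4.+1 2 isT.
Let v3 : V := @Ordinal n.+4.+1 3 isT.
Let u1 : 'I_n.+3 := @Ordinal n.+3 1 isT.

Hypothesis hx : degenerate_on [set ord0; u1] x h.

Let low (T : {set V}) := [forall j : V, (3 < j)%N ==> (j \notin T)].
Let full (T : {set V}) := [forall j : V, (3 < j)%N ==> (j \in T)].

Let lowP (T : {set V}) : reflect (forall j : V, j \in T -> (j <= 3)%N) (low T).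
Proof.
apply: (iffP forallP) => [lT j jT|lT j].
  by rewrite leqNgt; apply/negP => j3; move: (lT j); rewrite j3 jT.
by apply/implyP => j3; apply/negP => /lT; rewrite leqNgt j3.
Qed.

Let fullP (T : {set V}) : reflect (forall j : V, (3 < j)%N -> j \in T) (full T).
Proof.
by apply: (iffP forallP) => fT j; [exact/implyP|apply/implyP/fT].
Qed.

Let low_full (T : {set V}) : low T -> ~~ full T.
Proof. by move=> /lowP lT; apply/fullP => /(_ ord_max isT)/lT; rewrite /= ltnS. Qed.

Let fullU (v : V) (T : {set V}) : (v <= 3)%N -> full (v |: T) = full T.
Proof.
move=> vle; apply/fullP/fullP => fT j j3; last by rewrite !inE fT // orbT.
by have := fT j j3; rewrite !inE => /predU1P[jv|//]; rewrite jv ltnNge vle in j3.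
Qed.

Let fullD (v : V) (T : {set V}) : (v <= 3)%N -> full (T :\ v) = full T.
Proof.
move=> vle; apply/fullP/fullP => fT j j3; have := fT j j3; rewrite !inE.
  by case/andP.
by move=> ->; rewrite andbT; apply: contraTneq j3 => ->; rewrite -leqNgt.
Qed.

Let lowD (v : V) (T : {set V}) : (v <= 3)%N -> low (T :\ v) = low T.
Proof.
move=> vle; apply/lowP/lowP => lT j jT; last by apply: lT; rewrite !inE in jT; case/andP: jT.
by have [->//|jv] := eqVneq j v; apply: lT; rewrite !inE jv.
Qed.

Let lowU (v : V) (T : {set V}) : (v <= 3)%N -> low (v |: T) = low T.
Proof.
move=> vle; apply/lowP/lowP => lT j jT; first by apply: lT; rewrite !inE jT orbT.
by move: jT; rewrite !inE => /predU1P[->//|/lT].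
Qed.

Let inner_low (v w : V) (T : {set V}) : (w < v)%N -> w \in T -> ~~ low T -> (v <= 3)%N ->
  inner_vertex v T.
Proof.
move=> wv wT nlT vle; apply/andP; split; apply/existsP; first by exists w; rewrite wT.
move: nlT; rewrite negb_forall => /existsP[j]; rewrite negb_imply negbK => /andP[j3 jT].
by exists j; rewrite jT (leq_ltn_trans vle).
Qed.

Fact p0_homo : {homo (fun j : V => inord (j - 2) : 'I_n.+3) : i j / (i <= j)%O}.
Proof.
move=> i j; rewrite !leEord => ij; have := ltn_ord i; have := ltn_ord j => ? ?.
by rewrite !inordK; lia.
Qed.
Let p0 : delta n.+4 n.+2 := monotone p0_homo.

Fact p1_homo : {homo (fun j : V => inord (maxn 1 (j - 2)) : 'I_n.+3) : i j / (i <= j)%O}.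
Proof.
move=> i j; rewrite !leEord => ij; have := ltn_ord i; have := ltn_ord j => ? ?.
by rewrite !inordK; lia.
Qed.
Let p1 : delta n.+4 n.+2 := monotone p1_homo.

Fact q_homo : {homo (fun j : V => if (j <= 3)%N then v1 else j) : i j / (i <= j)%O}.
Proof.
move=> i j; rewrite !leEord => ij.
by case: ifP; case: ifP => //= *; lia.
Qed.
Let q : delta n.+4 n.+4 := monotone q_homo.

Fact i_homo : {homo (fun j : 'I_n.+3 => inord (if j == 0 :> nat then 0 else j.+2) : V)
  : i j / (i <= j)%O}.
Proof.
move=> i j; rewrite !leEord => ij; have := ltn_ord j; have := ltn_ord i.
by case: ifP; case: ifP => // *; rewrite !inordK; lia.
Qed.
Let i : delta n.+2 n.+4 := monotone i_homo.

Let iE (j : 'I_n.+3) : i j = (if j == 0 :> nat then 0 else j.+2) :> nat.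
Proof. by have := ltn_ord j => ? /=; rewrite inordK //; case: ifP; lia. Qed.

Let p0E (j : V) : p0 j = j - 2 :> nat.
Proof. by have := ltn_ord j => ? /=; rewrite inordK //; lia. Qed.

Let p1E (j : V) : p1 j = maxn 1 (j - 2) :> nat.
Proof. by have := ltn_ord j => ? /=; rewrite inordK //; lia. Qed.

(** G0, G1 and low are the three domains on
   which the horn determines the map, A0 is their union, A1 and A2 are the stages
   after filling at v3 and at v2, D0 and D1 are the domains glued to introduce v3 F,
   and A3 is the final stage, where v2 is dropped. *)
Let G0 (T : {set V}) := (v1 \notin T) && ~~ ((v3 \in T) && full T).
Let G1 (T : {set V}) := [&& v0 \notin T, v2 \notin T & ~~ full T].
Let G01 (T : {set V}) := G0 T || G1 T.
Let A0 (T : {set V}) := G01 T || low T.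
Let A1 (T : {set V}) := A0 T || (v0 \notin T) && ~~ full T.
Let A2 (T : {set V}) := ~~ ((v3 \in T) && full T).
Let D0 (T : {set V}) := (v2 \notin T) && A2 T.
Let D1 (T : {set V}) := (v0 \notin T) && (v2 \notin T).
Let D01 (T : {set V}) := D0 T || D1 T.
Let A3 (T : {set V}) := v2 \notin T.

Let low_closed : down_closed low.
Proof. by move=> S T /subsetP ST /lowP lT; apply/lowP => j /ST/lT. Qed.

Let nfull_closed : down_closed (fun T => ~~ full T).
Proof. by move=> S T /subsetP ST; apply: contra => /fullP fS; apply/fullP => j /fS/ST. Qed.

Let A2_closed : down_closed A2.
Proof.
rewrite /A2 => S T ST; rewrite !negb_and.
exact: (down_closedU (@avoids_closed _ v3) nfull_closed).
Qed.

Let G0_closed : down_closed G0.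
Proof. exact: (down_closedI (@avoids_closed _ v1) A2_closed). Qed.
Let G1_closed : down_closed G1.
Proof.
exact: (down_closedI (@avoids_closed _ v0) (down_closedI (@avoids_closed _ v2) nfull_closed)).
Qed.
Let G01_closed : down_closed G01. Proof. exact: down_closedU. Qed.
Let A0_closed : down_closed A0. Proof. exact: down_closedU. Qed.
Let A1_closed : down_closed A1.
Proof. exact: (down_closedU A0_closed (down_closedI (@avoids_closed _ v0) nfull_closed)). Qed.
Let D0_closed : down_closed D0. Proof. exact: (down_closedI (@avoids_closed _ v2)). Qed.
Let D1_closed : down_closed D1.
Proof. exact: (down_closedI (@avoids_closed _ v0) (@avoids_closed _ v2)). Qed.
Let D01_closed : down_closed D01. Proof. exact: down_closedU. Qed.
Let A3_closed : down_closed A3. Proof. exact: (@avoids_closed _ v2). Qed.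

Let G0_horn T : G0 T -> horn_family ord0 (p0 @: T).
Proof.
move=> /andP[_]; apply: contra => /subsetP hT.
have p0V (u : 'I_n.+3) (j : V) : u != ord0 -> (j = u.+2 :> nat) -> j \in T.
  move=> u0 ju; have := hT u; rewrite !inE => /(_ u0)/imsetP[j' j'T /(congr1 val)].
  rewrite /= inordK => [uj|]; last by have := ltn_ord j'; lia.
  have u0' : (u != 0 :> nat) by [].
  have -> : j = j' by apply: val_inj; rewrite /=; lia.
  by [].
apply/andP; split; first exact: (p0V u1).
apply/fullP => j j3; apply: (p0V (inord (j - 2))); have := ltn_ord j => ?.
  by rewrite -val_eqE /= inordK; lia.
by rewrite inordK; lia.
Qed.

Let G1_horn T : G1 T -> horn_family ord0 (p1 @: T).
Proof.
move=> /and3P[_ _]; apply: contra => /subsetP hT; apply/fullP => j j3.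
have jlt := ltn_ord j.
have := hT (inord (j - 2)); rewrite !inE -val_eqE /= inordK; last by lia.
have -> : (j - 2 != 0)%N by lia.
move=> /(_ isT)/imsetP[j' j'T /(congr1 val)]; have := ltn_ord j' => ?.
rewrite /= !inordK; try lia.
move=> uj; have -> // : j = j' by apply: val_inj; rewrite /=; lia.
Qed.

Let mem_f m (f : delta m n.+4) (v : V) y : v \notin image_set f -> f y != v.
Proof. by apply: contraNneq => <-; exact: mem_image_set. Qed.

Let A0_map : exists a : total_map n.+4 C,
  [/\ simplicial_on A0 a,
      agree_on G0 a (fun m f => h (delta_comp p0 f))
    & agree_on G1 a (fun m f => h (delta_comp p1 f))].
Proof.
have a0P := simplicial_on_pull G0_horn hP; have a1P := simplicial_on_pull G1_horn hP.
have [|a [aP a0 a1]] := glue G0_closed G1_closed a0P a1P.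
  move=> m f /andP[f1 _] /and3P[f0 f2 _]; congr (h _); apply: omorphism_ext => y.
  apply: val_inj => /=; have := ltn_ord (f y).
  move: (mem_f y f0) (mem_f y f1) (mem_f y f2); rewrite -!val_eqE /= => *.
  by rewrite !inordK; lia.
have lP : simplicial_on low (fun m (_ : delta m n.+4) => act (degen_map m) x).
  by move=> k m g f _; rewrite -act_comp; congr act; apply: omorphism_ext.
have [|b [bP ba _]] := glue G01_closed low_closed aP lP.
  move=> m f Af /lowP lf.
  have lf3 y : (f y <= 3)%N by apply: lf; exact: mem_image_set.
  case/orP: (Af) => Gf; [rewrite a0 //|rewrite a1 //]; rewrite hx //;
    apply/image_setP => y; have := lf3 y; rewrite !inE -!val_eqE /= => ?;
    by rewrite !inordK; lia.
exists b; split=> // m f Gf.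
  by rewrite ba ?a0 // /G01 Gf.
by rewrite ba ?a1 // /G01 Gf orbT.
Qed.

Ltac by_cases T :=
  rewrite /A3 /D01 /D0 /D1 /A2 /A1 /A0 /G01 /G0 /G1;
  move: (v0 \in T) (v1 \in T) (v2 \in T) (v3 \in T) (full T) (low T);
  by do 6!case.

(* The added faces contain v1 and v2, avoid v0 and meet F without containing it. *)
Let toggle_v3 T : A1 T -> ~~ A0 T -> [/\ A1 (v3 |: T), ~~ A0 (T :\ v3) & inner_vertex v3 T].
Proof.
move=> BT AT.
have vT : v1 \in T.
  by move: BT AT; by_cases T.
have nlT : ~~ low T by apply: contra AT; rewrite /A0 => ->; rewrite orbT.
split; last exact: (@inner_low v3 v1).
- by move: BT AT vT nlT; rewrite /A1 /A0 /G01 /G0 /G1 fullU // ?lowU // !inE /=; by_cases T.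
- move: BT AT vT nlT; rewrite /A1 /A0 /G01 /G0 /G1 fullD // lowD // !inE /=.
  by_cases T.
Qed.

(* The added faces contain v1 and meet F; those that contain F avoid v3. *)
Let toggle_v2 T : A2 T -> ~~ A1 T -> [/\ A2 (v2 |: T), ~~ A1 (T :\ v2) & inner_vertex v2 T].
Proof.
move=> BT AT.
have vT : v1 \in T.
  by move: BT AT; by_cases T.
have nlT : ~~ low T by apply: contra AT; rewrite /A1 /A0 => ->; rewrite orbT.
split; last exact: (@inner_low v2 v1).
- by move: BT; rewrite /A2 fullU // !inE.
- move: BT AT vT nlT; rewrite /A2 /A1 /A0 /G01 /G0 /G1 fullD // lowD // !inE /=.
  by_cases T.
Qed.

(* The added faces contain v0, v3 and F. *)
Let toggle_v1 T : A3 T -> ~~ D01 T -> [/\ A3 (v1 |: T), ~~ D01 (T :\ v1) & inner_vertex v1 T].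
Proof.
move=> BT AT.
have vT : v0 \in T.
  by move: BT AT; by_cases T.
have nlT : ~~ low T.
  apply: contra AT => /low_full; rewrite /D01 /D0 /D1 /A2 => /negbTE ->.
  by rewrite andbF andbT (BT : v2 \notin T).
split; last exact: (@inner_low v1 v0).
- by move: BT; rewrite /A3 !inE.
- by move: BT AT vT; rewrite /A3 /D01 /D0 /D1 /A2 fullD // !inE /=; by_cases T.
Qed.

Let A2_map : exists a : total_map n.+4 C,
  [/\ simplicial_on A2 a,
      agree_on G0 a (fun m f => h (delta_comp p0 f))
    & agree_on G1 a (fun m f => h (delta_comp p1 f))].
Proof.
have [a [aP a0 a1]] := A0_map.
have AA1 T : A0 T -> A1 T by rewrite /A1 => ->.
have BB2 T : A1 T -> A2 T.
  by have := @low_full T => /implyP; by_cases T.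
have [b [bP ba]] : extends A0 A2 a.
  apply: extends_trans AA1 (toggle_extends hC A0_closed A1_closed AA1 toggle_v3 aP) _.
  by move=> b bP _; exact: (toggle_extends hC A1_closed A2_closed BB2 toggle_v2 bP).
exists b; split=> // m f Gf.
  by rewrite ba ?a0 // /A0 /G01 Gf.
by rewrite ba ?a1 // /A0 /G01 Gf orbT.
Qed.

Lemma outer_horn_extends : extends (horn_family ord0) predT h.
Proof.
have [a [aP a0 a1]] := A2_map.
have qD1 T : D1 T -> A2 (q @: T).
  move=> _; rewrite /A2 negb_and; apply/orP; left; apply/imsetP => -[j _ /(congr1 val)] /=.
  by case: ifP => //= j3 j3'; rewrite -j3' in j3.
have q_id (w : V) : w != v0 -> w != v2 -> w != v3 -> q w = w.
  rewrite -!val_eqE /= => *; apply: val_inj; rewrite /=.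
  by case: ifP => //= *; lia.
have p1q (w : V) : p1 (q w) = p1 w.
  by apply: val_inj; rewrite [LHS]p1E [RHS]p1E /=; case: ifP => //= ?; lia.
have aqP := simplicial_on_pull qD1 aP.
have aP0 : simplicial_on D0 a by apply: simplicial_on_sub aP => T /andP[].
(* On faces that do not contain F both maps factor through p1, which is unchanged
   by q; on faces that contain F, hence not v3, q is the identity. *)
have [|b [bP ba _]] := glue D0_closed D1_closed aP0 aqP.
  move=> m f /andP[_ Bf] /andP[f0 f2].
  have [ff|nff] := boolP (full (image_set f)).
    have f3 : v3 \notin image_set f by move: Bf; rewrite /A2 ff andbT.
    congr (a _ _); apply: omorphism_ext => y; apply/esym/q_id; exact: mem_f.
  have fG : G1 (image_set f) by rewrite /G1 f0 f2 nff.
  have qfG : G1 (image_set (delta_comp q f)).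
    have nq (v : V) : v != v1 -> (v <= 3)%N -> v \notin image_set (delta_comp q f).
      move=> vv1 v3'; apply/imsetP => -[y _ /=]; case: ifP => [_ /eqP|fy vE].
        by rewrite (negbTE vv1).
      by rewrite -vE v3' in fy.
    rewrite /G1 !nq //=; apply: contra nff => /fullP ff; apply/fullP => j j3.
    have /imsetP[y _ /(congr1 val) /=] := ff j j3; case: ifP => /= [_ jE|_ /val_inj ->].
      by rewrite jE in j3.
    exact: mem_image_set.
  rewrite !a1 //; congr h; apply: omorphism_ext => y; exact/esym/p1q.
have AA3 T : D01 T -> A3 T.
  by_cases T.
have [c [cP cb]] := toggle_extends hC D01_closed A3_closed AA3 toggle_v1 bP.
have iB3 T : A3 (i @: T).
  rewrite /A3; apply/imsetP => -[j _ /(congr1 (@nat_of_ord _))]; rewrite iE /=.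
  by have := ltn_ord j => ?; case: ifP => //; lia.
exists (fun m f => c m (delta_comp i f)); split.
  by apply: simplicial_on_pull cP => T _; exact: iB3.
move=> m f hf.
have p0i : delta_comp p0 (delta_comp i f) = f.
  have p0iK (w : 'I_n.+3) : p0 (i w) = w.
    by apply: ord_inj; rewrite p0E iE; case: ifP => [/eqP ->|]; lia.
  by apply: omorphism_ext => y; exact: p0iK.
have if1 : v1 \notin image_set (delta_comp i f).
  by apply/imsetP => -[y _ /(congr1 (@nat_of_ord _))]; rewrite iE /=; case: ifP.
have if2 : A3 (image_set (delta_comp i f)) by rewrite image_set_comp.
have ifB : A2 (image_set (delta_comp i f)).
  apply: contraL hf => /andP[i3 /fullP fi]; rewrite negbK; apply/subsetP => u.
  rewrite !inE -val_eqE /= => u0; have := ltn_ord u => ult.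
  have inj (v : V) : v = u.+2 :> nat -> v \in image_set (delta_comp i f) -> u \in image_set f.
    move=> vu /imsetP[y _ /(congr1 (@nat_of_ord _))]; rewrite iE vu; case: ifP => // _ [uf].
    by have -> : u = f y; [exact: val_inj|exact: mem_image_set].
  have [u1E|u1'] := eqVneq (u : nat) 1%N; first by apply: inj i3; rewrite /= u1E.
  apply: (@inj (inord u.+2)); first by rewrite inordK; lia.
  by apply: fi; rewrite inordK; lia.
have Df : D0 (image_set (delta_comp i f)) by rewrite /D0 ifB andbT.
rewrite cb ?ba ?a0 ?p0i //; last by rewrite /D01 Df.
by rewrite /G0 if1.
Qed.
End OuterHorn.

(** As v is the first vertex of T and w the second, the horn induced on T is the
    outer horn at 0 with a degenerate first edge; the vertex z ensures that its
    dimension is at least 2. *)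
Lemma outer_cell_extends M C (A : face_family M) (T : {set 'I_M.+1}) v w z x
    (a : total_map M C) :
  is_quasicategory C -> down_closed A -> v \in T -> w \in T -> z \in T ->
  (v < w)%N -> (w < z)%N -> (forall t, t \in T -> t = v \/ (w <= t)%N) ->
  degenerate_on [set v; w] x a -> ~~ A (T :\ v) ->
  (forall t, t \in T -> t != v -> A (T :\ t)) -> simplicial_on A a ->
  extends A (fun S => A S || (S \subset T)) a.
Proof.
move=> hC Acl vT wT zT vw wz Tvw ax AT AD aP.
apply: cell_extends AT AD aP _ => // n i k iT i_inj ik ai aiP.
have i_lt p q : (i p < i q)%N -> (p < q)%N by exact: homo_lt_reflect.
have i_le (p q : 'I_n.+1) : (p <= q)%N -> (i p <= i q)%N by exact: (omorph_le i).
have /imsetP[jw _ jwE] : w \in image_set i by rewrite iT.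
have /imsetP[jz _ jzE] : z \in image_set i by rewrite iT.
have kw : (k < jw)%N by apply: i_lt; rewrite ik -jwE.
have wzj : (jw < jz)%N by apply: i_lt; rewrite -jwE -jzE.
have [n' nE] : exists n', n = n'.+2 by exists n.-2; have := ltn_ord jz; lia.
subst n.
have i_T p : i p \in T by rewrite -iT mem_image_set.
have k0 : k = ord0.
  apply: ord_inj => /=; apply/eqP; rewrite -leqn0 leqNgt; apply/negP => k_gt0.
  have := i_le ord0 k (leq0n _); have [i0|] := Tvw _ (i_T ord0).
    by move: k_gt0; rewrite -ik in i0; rewrite -(i_inj _ _ i0).
  by rewrite ik; lia.
subst k; apply: outer_horn_extends hC aiP _ => m f /image_setP f01.
apply: (ax _ (delta_comp i f)); apply/image_setP => y /=; have := f01 y; rewrite !inE.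
case/orP => /eqP ->; first by rewrite ik eqxx.
apply/orP; right; apply/eqP/ord_inj; apply/eqP; rewrite eqn_leq; apply/andP; split.
  by rewrite jwE; apply: i_le; rewrite /=; lia.
have [i1|//] := Tvw _ (i_T (@Ordinal n'.+3 1 isT)).
by rewrite -ik in i1; have := i_inj _ _ i1.
Qed.

(** * Triangles *)

(** Monotone maps between small ordinals, given by their list of values. *)
Definition is_table M n (s : seq nat) :=
  [&& sorted leq s, size s == M.+1 & all (fun i => i <= n)%N s].

Fact table_homo M n s : is_table M n s ->
  {homo (fun j : 'I_M.+1 => inord (nth 0 s j) : 'I_n.+1) : i j / (i <= j)%O}.
Proof.
move=> /and3P[s_sorted /eqP s_size /allP s_n] i j ij.
have s_lt (k : 'I_M.+1) : (nth 0 s k < n.+1)%N by rewrite ltnS s_n // mem_nth ?s_size.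
rewrite leEord !inordK //.
by apply: (sorted_leq_nth leq_trans leqnn) => //; rewrite inE s_size.
Qed.

Definition table M n s (sP : is_table M n s) : delta M n := monotone (table_homo sP).

Lemma tableE M n s (sP : is_table M n s) j : table sP j = nth 0 s j :> nat.
Proof.
have /and3P[_ /eqP s_size /allP s_n] := sP.
by rewrite /= inordK // ltnS s_n // mem_nth ?s_size.
Qed.

Lemma act_simplicial M n (C : sSet) (A : face_family M) (r : delta M n) (s : C n) :
  simplicial_on A (fun m f => act (delta_comp r f) s).
Proof. by move=> k m h f _; rewrite delta_compA act_comp. Qed.

(** Compares the maps carried by two cells s, s' on simplices f lying in their
    common face: both restrict there to the same simplex of dimension k. *)
Lemma act_agree m M n n' k (C : sSet) (f : delta m M) (r : delta M n) (r' : delta M n')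
    (t : delta M k) (d : delta k n) (d' : delta k n') (s : C n) (s' : C n') :
  (forall y, r (f y) = d (t (f y))) -> (forall y, r' (f y) = d' (t (f y))) ->
  act d s = act d' s' -> act (delta_comp r f) s = act (delta_comp r' f) s'.
Proof.
move=> rd rd' ss'.
have -> : delta_comp r f = delta_comp d (delta_comp t f) by exact: omorphism_ext.
have -> : delta_comp r' f = delta_comp d' (delta_comp t f) by exact: omorphism_ext.
by rewrite !act_comp ss'.
Qed.

(** The edges of a triangle; eij is the edge from vertex i to vertex j. *)
Definition e01 : delta 1 2 := table (erefl : is_table 1 2 [:: 0; 1]).
Definition e12 : delta 1 2 := table (erefl : is_table 1 2 [:: 1; 2]).
Definition e02 : delta 1 2 := table (erefl : is_table 1 2 [:: 0; 2]).

Lemma coface2_max : coface ord_max = e01 :> delta 1 2.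
Proof. by apply: omorphism_ext => -[[|[|]] // ?]; apply: ord_inj; rewrite tableE. Qed.

Lemma coface2_0 : coface ord0 = e12 :> delta 1 2.
Proof. by apply: omorphism_ext => -[[|[|]] // ?]; apply: ord_inj; rewrite tableE. Qed.

Lemma coface2_1 : coface (@Ordinal 3 1 isT) = e02 :> delta 1 2.
Proof. by apply: omorphism_ext => -[[|[|]] // ?]; apply: ord_inj; rewrite tableE. Qed.

Lemma is_triangleE (X : sSet) (x y z : X 0) (f : edge X x y) (g : edge X y z)
    (h : edge X x z) :
  is_triangle f g h <-> exists s : X 2, [/\ act e01 s = f, act e12 s = g & act e02 s = h].
Proof. by rewrite /is_triangle coface2_max coface2_0 coface2_1. Qed.

Lemma composite_exists (X : sSet) (hX : is_quasicategory X) (x y z : X 0)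
  (f : edge X x y) (g : edge X y z) : exists h : edge X x z, is_triangle f g h.
Proof.
pose r : delta 2 1 := table (erefl : is_table 2 1 [:: 0; 1; 1]).
pose r' : delta 2 1 := table (erefl : is_table 2 1 [:: 0; 0; 1]).
have rP : simplicial_on (avoids (ord_max : 'I_3)) 
    (fun m u => act (delta_comp r u) (f : X 1)) by exact: act_simplicial.
have rP' : simplicial_on (avoids (ord0 : 'I_3)) 
    (fun m u => act (delta_comp r' u) (g : X 1)) by exact: act_simplicial.
have [|a [aP ar ar']] := glue (@avoids_closed _ _) (@avoids_closed _ _) rP rP'.
  move=> m u u2 u0.
  have uy i : u i = @Ordinal 3 1 isT.
    have : u i != ord_max by apply: contraNneq u2 => <-; exact: mem_image_set.
    have : u i != ord0 by apply: contraNneq u0 => <-; exact: mem_image_set.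
    by case: (u i) => [[|[|[|]]] // ?] _ _; apply: ord_inj.
  apply: (@act_agree _ _ _ _ 0 _ _ _ _ (degen_map 2) (vertex_map ord_max) (vertex_map ord0)).
  - by move=> i; apply: ord_inj; rewrite uy tableE.
  - by move=> i; apply: ord_inj; rewrite uy tableE.
  - exact: etrans (edge_tgt f) (esym (edge_src g)).
have [|s sa] := extends_simplex (@inner_horn_extends X 2 (@Ordinal 3 1 isT) a hX isT _).
  apply: simplicial_on_sub aP => T /subsetPn[j]; rewrite !inE /avoids.
  by case: j => [[|[|[|]]] // hj] _; [set j := Ordinal hj; have -> : j = ord0 by exact: ord_inj|
    set j := Ordinal hj; have -> : j = ord_max by exact: ord_inj] => ->; rewrite ?orbT.
have s01 : act e01 s = f.
  have im : (ord_max : 'I_3) \notin image_set e01.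
    by apply/imsetP => -[i _ /(congr1 (@nat_of_ord _))]; rewrite tableE; case: i => [[|[|]]].
  rewrite sa ?ar //; last first.
    by apply/subsetPn; exists ord_max; rewrite ?inE.
  rewrite -[RHS]act_id; congr act; apply: omorphism_ext => -[[|[|]] // ?];
    by apply: ord_inj; rewrite /= !inordK.
have s12 : act e12 s = g.
  have im : (ord0 : 'I_3) \notin image_set e12.
    by apply/imsetP => -[i _ /(congr1 (@nat_of_ord _))]; rewrite tableE; case: i => [[|[|]]].
  rewrite sa ?ar' //; last first.
    by apply/subsetPn; exists ord0; rewrite ?inE.
  rewrite -[RHS]act_id; congr act; apply: omorphism_ext => -[[|[|]] // ?];
    by apply: ord_inj; rewrite /= !inordK.
have e_src : src (act e02 s) = x.
  rewrite -(edge_src f) -s01 /src /vertex -!act_comp; congr act.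
  by apply: omorphism_ext => i; apply: ord_inj; rewrite /= !inordK.
have e_tgt : tgt (act e02 s) = z.
  rewrite -(edge_tgt g) -s12 /tgt /vertex -!act_comp; congr act.
  by apply: omorphism_ext => i; apply: ord_inj; rewrite /= !inordK.
by exists (Edge e_src e_tgt); apply/is_triangleE; exists s.
Qed.

(** * Homotopic edges *)

Definition t3_0 : 'I_4 := @Ordinal 4 0 isT.
Definition t3_1 : 'I_4 := @Ordinal 4 1 isT.
Definition t3_2 : 'I_4 := @Ordinal 4 2 isT.
Definition t3_3 : 'I_4 := @Ordinal 4 3 isT.

Lemma faces_agree (X : sSet) (s s' : X 2) (r r' : delta 3 2) (t : delta 3 1)
    (d d' : delta 1 2) (i j : 'I_4) :
  (forall w, w != i -> w != j -> r w = d (t w) /\ r' w = d' (t w)) ->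
  act d s = act d' s' ->
  forall m (f : delta m 3), avoids i (image_set f) -> avoids j (image_set f) ->
  act (delta_comp r f) s = act (delta_comp r' f) s'.
Proof.
move=> rd ss' m f /avoidsP fi /avoidsP fj; apply: (act_agree (t := t) _ _ ss') => y;
by have [] := rd _ (fi y) (fj y).
Qed.

(** The three given facets, opposite to i, i' and i'', cover the inner horn at k;
    the r's are retractions of the tetrahedron onto them. *)
Lemma horn3_extends (X : sSet) (hX : is_quasicategory X) (k : 'I_4)
    (r r' r'' : delta 3 2) (i i' i'' : 'I_4) (s s' s'' : X 2) :
  (0 < k < 3)%N -> [&& i != k, i' != k & i'' != k] ->
  (forall j, j != k -> [|| j == i, j == i' | j == i'']) ->
  (forall m (f : delta m 3), avoids i (image_set f) -> avoids i' (image_set f) ->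
    act (delta_comp r f) s = act (delta_comp r' f) s') ->
  (forall m (f : delta m 3), avoids i (image_set f) -> avoids i'' (image_set f) ->
    act (delta_comp r f) s = act (delta_comp r'' f) s'') ->
  (forall m (f : delta m 3), avoids i' (image_set f) -> avoids i'' (image_set f) ->
    act (delta_comp r' f) s' = act (delta_comp r'' f) s'') ->
  exists u : X 3, forall m (f : delta m 3),
    [/\ avoids i (image_set f) -> act f u = act (delta_comp r f) s,
        avoids i' (image_set f) -> act f u = act (delta_comp r' f) s'
      & avoids i'' (image_set f) -> act f u = act (delta_comp r'' f) s''].
Proof.
move=> hk /and3P[ik1 ik2 ik3] ik agr agr' agr''.
have [//|a [aP ar ar']] := glue (@avoids_closed _ i) (@avoids_closed _ i')
  (act_simplicial r s) (act_simplicial r' s').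
have [|b [bP ba br'']] := glue (down_closedU (@avoids_closed _ i) (@avoids_closed _ i'))
  (@avoids_closed _ i'') aP (act_simplicial r'' s'').
  by move=> m f /orP[fi|fi'] fi''; [rewrite ar ?agr'|rewrite ar' ?agr''].
have [|u ub] := extends_simplex (@inner_horn_extends X 3 k b hX hk _).
  apply: simplicial_on_sub bP => T /subsetPn[j]; rewrite !inE => /ik.
  by rewrite /avoids => /or3P[] /eqP-> ->; rewrite ?orbT.
have hf (j : 'I_4) m (f : delta m 3) : j != k -> avoids j (image_set f) ->
    horn_family k (image_set f).
  by move=> jk jf; apply/subsetPn; exists j; rewrite ?inE.
exists u => m f; split=> fi.
- by rewrite ub ?(hf i) // ba ?ar // fi.
- by rewrite ub ?(hf i') // ba ?ar' // fi orbT.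
- by rewrite ub ?(hf i'') // br''.
Qed.

Lemma act_table_edge (X : sSet) (u : X 3) (s : X 2) (d : delta 2 3) (r : delta 3 2)
    (e e' : delta 1 2) (i : 'I_4) :
  (forall m (f : delta m 3), avoids i (image_set f) -> act f u = act (delta_comp r f) s) ->
  (forall w, d (e w) != i) -> (forall w, r (d (e w)) = e' w) ->
  act e (act d u) = act e' s.
Proof.
move=> us de rde; rewrite -act_comp us; last exact/avoidsP.
by congr act; exact: omorphism_ext.
Qed.

(** dijk includes the facet with vertices i, j, k into the tetrahedron, and rijk is
    a retraction of it; the value of rijk at the vertex opposite to the facet is
    immaterial. *)
Definition d013 : delta 2 3 := table (erefl : is_table 2 3 [:: 0; 1; 3]).
Definition d023 : delta 2 3 := table (erefl : is_table 2 3 [:: 0; 2; 3]).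
Definition r012 : delta 3 2 := table (erefl : is_table 3 2 [:: 0; 1; 2; 2]).
Definition r013 : delta 3 2 := table (erefl : is_table 3 2 [:: 0; 1; 1; 2]).
Definition r023 : delta 3 2 := table (erefl : is_table 3 2 [:: 0; 0; 1; 2]).
Definition r123 : delta 3 2 := table (erefl : is_table 3 2 [:: 0; 0; 1; 2]).

Ltac by_cases4 :=
  case=> [[|[|[|[|]]]] // ?] // _ _; split; apply: ord_inj; rewrite !tableE.

Ltac by_cases2 :=
  case=> [[|[|]] // ?]; first [by apply: ord_inj; rewrite !tableE
    | by apply/eqP => /(congr1 (@nat_of_ord _)); rewrite !tableE].

Lemma horn3_1 (X : sSet) (hX : is_quasicategory X) (s123 s013 s012 : X 2) :
  act e12 s012 = act e01 s123 -> act e01 s012 = act e01 s013 ->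
  act e12 s013 = act e02 s123 ->
  exists s023 : X 2, [/\ act e01 s023 = act e02 s012, act e12 s023 = act e12 s123
    & act e02 s023 = act e02 s013].
Proof.
move=> h12 h01 h13.
have [||||||u uP] := @horn3_extends X hX t3_1 r012 r123 r013 t3_3 t3_0 t3_2 s012 s123 s013.
- by [].
- by [].
- by case=> [[|[|[|[|]]]] // ?].
- apply: (@faces_agree _ _ _ _ _ (table (erefl : is_table 3 1 [:: 0; 0; 1; 1])) _ _ _ _ _ h12).
  by by_cases4.
- apply: (@faces_agree _ _ _ _ _ (table (erefl : is_table 3 1 [:: 0; 1; 1; 1])) _ _ _ _ _ h01).
  by by_cases4.
- apply: (@faces_agree _ _ _ _ _ (table (erefl : is_table 3 1 [:: 0; 0; 0; 1])) _ _ _ _ _ (esym h13)).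
  by by_cases4.
have u012 m (f : delta m 3) := let: And3 p _ _ := uP m f in p.
have u123 m (f : delta m 3) := let: And3 _ p _ := uP m f in p.
have u013 m (f : delta m 3) := let: And3 _ _ p := uP m f in p.
exists (act d023 u); split.
- apply: (act_table_edge u012) ; by_cases2.
- apply: (act_table_edge u123) ; by_cases2.
- apply: (act_table_edge u013) ; by_cases2.
Qed.

Lemma horn3_2 (X : sSet) (hX : is_quasicategory X) (s123 s023 s012 : X 2) :
  act e12 s012 = act e01 s123 -> act e02 s012 = act e01 s023 ->
  act e12 s023 = act e12 s123 ->
  exists s013 : X 2, [/\ act e01 s013 = act e01 s012, act e12 s013 = act e02 s123
    & act e02 s013 = act e02 s023].
Proof.
move=> h12 h02 h23.
have [||||||u uP] := @horn3_extends X hX t3_2 r012 r123 r023 t3_3 t3_0 t3_1 s012 s123 s023.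
- by [].
- by [].
- by case=> [[|[|[|[|]]]] // ?].
- apply: (@faces_agree _ _ _ _ _ (table (erefl : is_table 3 1 [:: 0; 0; 1; 1])) _ _ _ _ _ h12).
  by by_cases4.
- apply: (@faces_agree _ _ _ _ _ (table (erefl : is_table 3 1 [:: 0; 0; 1; 1])) _ _ _ _ _ h02).
  by by_cases4.
- apply: (@faces_agree _ _ _ _ _ (table (erefl : is_table 3 1 [:: 0; 0; 0; 1])) _ _ _ _ _ (esym h23)).
  by by_cases4.
have u012 m (f : delta m 3) := let: And3 p _ _ := uP m f in p.
have u123 m (f : delta m 3) := let: And3 _ p _ := uP m f in p.
have u023 m (f : delta m 3) := let: And3 _ _ p := uP m f in p.
exists (act d013 u); split.
- apply: (act_table_edge u012); by_cases2.
- apply: (act_table_edge u123); by_cases2.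
- apply: (act_table_edge u023); by_cases2.
Qed.

Lemma triangle_id_l (X : sSet) (x y : X 0) (f : edge X x y) :
  is_triangle (degen_edge x) f f.
Proof.
case: f => f fx fy; subst x y.
apply/is_triangleE; exists (act (table (erefl : is_table 2 1 [:: 0; 0; 1])) f).
split; rewrite /= -?act_comp.
- congr act.
  by apply: omorphism_ext => i; apply: ord_inj; rewrite tableE;
    case: i => [[|[|]] // ?]; rewrite tableE.
- rewrite -[RHS]act_id; congr act.
  by apply: omorphism_ext => -[[|[|]] // ?]; apply: ord_inj; rewrite !tableE.
- rewrite -[RHS]act_id; congr act.
  by apply: omorphism_ext => -[[|[|]] // ?]; apply: ord_inj; rewrite !tableE.
Qed.

Lemma triangle_id_r (X : sSet) (x y : X 0) (f : edge X x y) :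
  is_triangle f (degen_edge y) f.
Proof.
case: f => f fx fy; subst x y.
apply/is_triangleE; exists (act (table (erefl : is_table 2 1 [:: 0; 1; 1])) f).
split; rewrite /= -?act_comp.
- rewrite -[RHS]act_id; congr act.
  by apply: omorphism_ext => -[[|[|]] // ?]; apply: ord_inj; rewrite !tableE.
- congr act.
  by apply: omorphism_ext => i; apply: ord_inj; rewrite tableE;
    case: i => [[|[|]] // ?]; rewrite tableE.
- rewrite -[RHS]act_id; congr act.
  by apply: omorphism_ext => -[[|[|]] // ?]; apply: ord_inj; rewrite !tableE.
Qed.

(** This lemma and the next are the two inner horns of a tetrahedron, read as
    associativity laws; the calculus of homotopic edges is derived from them. *)
Lemma triangle_assoc_l (X : sSet) (hX : is_quasicategory X) (x y z w : X 0)
    (f01 : edge X x y) (f12 : edge X y z) (f23 : edge X z w)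
    (f02 : edge X x z) (f13 : edge X y w) (f03 : edge X x w) :
  is_triangle f01 f12 f02 -> is_triangle f12 f23 f13 -> is_triangle f01 f13 f03 ->
  is_triangle f02 f23 f03.
Proof.
move=> /is_triangleE[s [sa sb sc]] /is_triangleE[t [ta tb tc]] /is_triangleE[u [ua ub uc]].
apply/is_triangleE.
have [|||r [ra rb rc]] := @horn3_1 X hX t u s; try congruence.
by exists r; split; congruence.
Qed.

Lemma triangle_assoc_r (X : sSet) (hX : is_quasicategory X) (x y z w : X 0)
    (f01 : edge X x y) (f12 : edge X y z) (f23 : edge X z w)
    (f02 : edge X x z) (f13 : edge X y w) (f03 : edge X x w) :
  is_triangle f01 f12 f02 -> is_triangle f12 f23 f13 -> is_triangle f02 f23 f03 ->
  is_triangle f01 f13 f03.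
Proof.
move=> /is_triangleE[s [sa sb sc]] /is_triangleE[t [ta tb tc]] /is_triangleE[u [ua ub uc]].
apply/is_triangleE.
have [|||r [ra rb rc]] := @horn3_2 X hX t u s; try congruence.
by exists r; split; congruence.
Qed.

Section Homotopy.
Variables (X : sSet) (hX : is_quasicategory X).

Definition homotopic (x y : X 0) (f g : edge X x y) := is_triangle f (degen_edge y) g.

Lemma homotopic_refl x y (f : edge X x y) : homotopic f f.
Proof. exact: triangle_id_r. Qed.

Lemma homotopic_sym x y (f g : edge X x y) : homotopic f g -> homotopic g f.
Proof.
move=> fg; exact: (triangle_assoc_l hX fg (triangle_id_l _) (triangle_id_r _)).
Qed.

Lemma triangle_homotopic x y z (f : edge X x y) (g : edge X y z) (h h' : edge X x z) :
  is_triangle f g h -> is_triangle f g h' -> homotopic h h'.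
Proof. by move=> fgh; apply: (triangle_assoc_l hX fgh); exact: triangle_id_r. Qed.

Lemma homotopic_triangle x y z (f : edge X x y) (g : edge X y z) (h h' : edge X x z) :
  is_triangle f g h -> homotopic h h' -> is_triangle f g h'.
Proof. by move=> fgh; apply: (triangle_assoc_r hX fgh); exact: triangle_id_r. Qed.

Lemma homotopic_triangle_r x y z (f : edge X x y) (g g' : edge X y z) (h : edge X x z) :
  is_triangle f g h -> homotopic g g' -> is_triangle f g' h.
Proof. by move=> fgh gg'; apply: (triangle_assoc_r hX fgh gg'); exact: triangle_id_r. Qed.

Lemma homotopic_trans x y (f g h : edge X x y) :
  homotopic f g -> homotopic g h -> homotopic f h.
Proof. exact: homotopic_triangle. Qed.

(** The edges obtained by composing the edges of a path, starting from its end.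
    They form a single homotopy class, and congruent paths have the same composites,
    so that this describes the homotopy category by edges instead of paths. *)
Fixpoint path_composite (x y : X 0) (p : epath X x y) : edge X x y -> Prop :=
  match p with
  | pnil x => fun e => homotopic (degen_edge x) e
  | pcons x y z f p' => fun e => exists2 g, path_composite p' g & is_triangle f g e
  end.

Lemma path_composite_exists x y (p : epath X x y) : exists e, path_composite p e.
Proof.
elim: p => [z|u v w f p [g pg]] /=; first by exists (degen_edge z); exact: homotopic_refl.
by have [e fge] := composite_exists hX f g; exists e, g.
Qed.

Lemma path_composite_homotopic x y (p : epath X x y) e e' :
  path_composite p e -> homotopic e e' -> path_composite p e'.
Proof.
case: p e e' => [z|u v w f p] e e' /=; first exact: homotopic_trans.
by move=> [g pg fge] ee'; exists g => //; exact: homotopic_triangle ee'.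
Qed.

Lemma path_composite_unique x y (p : epath X x y) e e' :
  path_composite p e -> path_composite p e' -> homotopic e e'.
Proof.
elim: p e e' => [z|u v w f p IHp] e e' /=.
  by move=> /homotopic_sym ze ze'; exact: homotopic_trans ze'.
move=> [g pg fge] [g' pg' fge']; apply: triangle_homotopic fge'.
exact: homotopic_triangle_r fge (IHp _ _ pg pg').
Qed.

Lemma path_composite_cat x y z (p : epath X x y) (q : epath X y z) g h e :
  path_composite p g -> path_composite q h -> is_triangle g h e ->
  path_composite (pcat p q) e.
Proof.
elim: p q g h e => [u|u v w f p IHp] q g h e /=.
  move=> ug qh ghe; apply: (path_composite_homotopic qh).
  apply: triangle_homotopic ghe; exact: (triangle_assoc_l hX ug (triangle_id_l _) (triangle_id_l _)).
move=> [g' pg' fg'g] qh ghe; have [k g'hk] := composite_exists hX g' h.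
exists k; first exact: IHp g'hk.
exact: (triangle_assoc_r hX fg'g g'hk ghe).
Qed.

Lemma path_composite_cong x y (p q : epath X x y) :
  pcong p q -> forall e, path_composite p e <-> path_composite q e.
Proof.
elim=> {x y p q} /=.
- move=> x e; split=> [[g xg ge]|xe]; last by exists e => //; exact: triangle_id_l.
  by apply: homotopic_trans xg _; exact: triangle_homotopic (triangle_id_l _) ge.
- move=> x y z f g h fgh e; split.
    move=> [k [l zl gkl] fke].
    exists (degen_edge z); first exact: homotopic_refl.
    apply: triangle_homotopic fgh _.
    apply: homotopic_triangle_r fke _; apply: homotopic_sym.
    apply: triangle_homotopic gkl; apply: homotopic_triangle_r zl; exact: triangle_id_r.
  move=> [k zk hke]; exists g; last first.
    apply: homotopic_triangle fgh _; apply: triangle_homotopic hke.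
    apply: homotopic_triangle_r zk; exact: triangle_id_r.
  by exists (degen_edge z); [exact: homotopic_refl|exact: triangle_id_r].
- by [].
- by move=> x y p q _ pq e; rewrite pq.
- by move=> x y p q r _ pq _ qr e; rewrite pq.
- move=> x y z p p' q q' _ pp' _ qq' e.
  have cat_cong (a a' : epath X x y) (b b' : epath X y z) :
      (forall e, path_composite a e <-> path_composite a' e) ->
      (forall e, path_composite b e <-> path_composite b' e) ->
      path_composite (pcat a b) e -> path_composite (pcat a' b') e.
    move=> aa' bb' abe; have [g ag] := path_composite_exists a.
    have [h bh] := path_composite_exists b; have [k ghk] := composite_exists hX g h.
    have kab := path_composite_cat ag bh ghk.
    apply: (path_composite_homotopic _ (path_composite_unique kab abe)).
    by apply: path_composite_cat ghk; [apply/aa'|apply/bb'].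
  by split; apply: cat_cong => // ?; rewrite ?pp' ?qq'.
Qed.

(** Both e and e' are composites of the path that consists of e' alone. *)
Lemma tau1_edge_homotopic x y (e e' : edge X x y) :
  tau1_edge e = tau1_edge e' -> homotopic e e'.
Proof.
move=> /tau1_classP/path_composite_cong ee'.
have /ee'[g yg e'ge] : path_composite (pcons e (pnil y)) e.
  by exists (degen_edge y); [exact: homotopic_refl|exact: triangle_id_r].
apply: homotopic_sym; apply: homotopic_triangle_r e'ge _; exact: homotopic_sym.
Qed.

End Homotopy.

(** * The join of a span and a simplex *)

(** A map between subcomplexes of simplices is determined by its values on the
    vertices; the default value is only taken on vertices outside A. *)
Definition vertex_fun k m (A : ssubset (simplex k)) (g : smap A (simplex m))
    (i : 'I_k.+1) : 'I_m.+1 :=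
  match pselect (smem A (vertex_map i : simplex k 0)) with
  | left iA => (g 0 (exist _ _ iA) : delta 0 m) ord0
  | right _ => ord0
  end.

Lemma vertex_funE k m (A : ssubset (simplex k)) (g : smap A (simplex m)) l
    (f : simplex k l) (fA : smem A f) j :
  (g l (exist _ f fA) : delta l m) j = vertex_fun g ((f : delta l k) j).
Proof.
rewrite /vertex_fun; case: pselect => [h|]; last first.
  case; have := smem_act (vertex_map j) fA; congr (smem A _).
  exact: omorphism_ext.
have <- : act (vertex_map j) (exist _ f fA : A l) = exist _ _ h.
  by apply: eq_exist; exact: omorphism_ext.
by rewrite smap_nat.
Qed.

Lemma sval_inj T (P : T -> Prop) : injective (@sval T P).
Proof. by move=> [u uP] [v vP] /= uv; exact: eq_exist. Qed.

Local Notation K := span_shape.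

(** A simplex of the join of the span b <- a -> c with an m-simplex is a simplex of
    the (m + 3)-simplex that does not have both b and c among its vertices: the
    vertices a, b, c are placed at 0, 1, 2, and vertex i of the m-simplex at 3 + i. *)
Section Decode.
Variables (m k : nat) (z : join K (simplex m) k).

Let vl := vertex_fun (smap_comp (ssub_incl (@horn 2 ord0)) (join_l z)).
Let vr := vertex_fun (join_r z).

Let code (i : 'I_k.+1) : 'I_m.+4 :=
  if join_cut z i then inord (3 + vr i) else inord (vl i).

Let code_l i : join_cut z i = false -> code i = vl i :> nat.
Proof.
by rewrite /code => ->; rewrite inordK //; have := ltn_ord (vl i); lia.
Qed.

Let code_r i : join_cut z i -> code i = 3 + vr i :> nat.
Proof.
by rewrite /code => ->; rewrite inordK //; have := ltn_ord (vr i); lia.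
Qed.

Let edge_cut_part i j (ij : (i <= j)%O) b : join_cut z i = b -> join_cut z j = b ->
  smem (cut_part (join_cut z) b) (edge_map ij : simplex k 1).
Proof. by move=> ib jb t; rewrite /= /edge_fun; case: ifP. Qed.

Fact decode_homo : {homo code : i j / (i <= j)%O}.
Proof.
move=> i j ij; rewrite leEord; have := omorph_le (join_cut z) ij.
case iC: (join_cut z i); case jC: (join_cut z j) => // _.
- rewrite !code_r // leq_add2l.
  have := vertex_funE (join_r z) (edge_cut_part ij iC jC); set g := (join_r z _ _).
  move=> gE; rewrite /vr -[i]/(edge_map ij ord0) -[X in vertex_fun _ X]/(edge_map ij ord0).
  have := omorph_le (g : delta 1 m) (isT : (ord0 <= ord_max :> 'I_2)%O).
  by rewrite leEord !gE.
- by rewrite code_l // code_r //; have := ltn_ord (vl i); lia.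
- rewrite !code_l //.
  have := vertex_funE (smap_comp (ssub_incl (@horn 2 ord0)) (join_l z)) (edge_cut_part ij iC jC).
  set g := (smap_comp _ _ _ _) => gE.
  have := omorph_le (g : delta 1 2) (isT : (ord0 <= ord_max :> 'I_2)%O).
  by rewrite leEord !gE.
Qed.

Definition decode : delta k m.+3 := monotone decode_homo.

Lemma decode_cut i : join_cut z i = (3 <= decode i)%N.
Proof.
case iC: (join_cut z i); first by rewrite [decode i]/(code i) code_r.
by rewrite [decode i]/(code i) code_l // leqNgt ltn_ord.
Qed.

Lemma decode_l l (f : simplex k l) fC j :
  (sval (join_l z l (exist _ f fC)) : delta l 2) j = decode ((f : delta l k) j) :> nat.
Proof.
rewrite [decode _]/(code _) code_l; last exact: fC.
by rewrite /vl -(vertex_funE _ fC).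
Qed.

Lemma decode_r l (f : simplex k l) fC j :
  3 + (join_r z l (exist _ f fC) : delta l m) j = decode ((f : delta l k) j) :> nat.
Proof.
rewrite [decode _]/(code _) code_r; last exact: fC.
by rewrite /vr -(vertex_funE _ fC).
Qed.
End Decode.

Lemma decode_inj m k (z z' : join K (simplex m) k) : decode z = decode z' -> z = z'.
Proof.
move=> zz'; apply: join_simplex_ext => [i|l g ga gb|l g ga gb].
- by rewrite !decode_cut zz'.
- apply: sval_inj; apply: omorphism_ext => j; apply: ord_inj.
  by rewrite !decode_l zz'.
- apply: omorphism_ext => j; apply: ord_inj; apply/eqP.
  by rewrite -(eqn_add2l 3) !decode_r zz'.
Qed.


Lemma decode_unique m k (z : join K (simplex m) k) (g : delta k m.+3) :
  (forall i, join_cut z i = (3 <= g i)%N) ->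
  (forall l (f : simplex k l) fC j,
    (sval (join_l z l (exist _ f fC)) : delta l 2) j = g ((f : delta l k) j) :> nat) ->
  (forall l (f : simplex k l) fC j,
    3 + (join_r z l (exist _ f fC) : delta l m) j = g ((f : delta l k) j) :> nat) ->
  decode z = g.
Proof.
move=> gC gl gr; apply: omorphism_ext => i; apply: ord_inj.
case iC: (join_cut z i).
  have fC : smem (cut_part (join_cut z) true) (vertex_map i : simplex k 0) by [].
  by rewrite -(decode_r fC ord0) (gr _ _ fC ord0).
have fC : smem (cut_part (join_cut z) false) (vertex_map i : simplex k 0) by [].
by rewrite -(decode_l fC ord0) (gl _ _ fC ord0).
Qed.

Lemma decode_act m k l (h : delta l k) (z : join K (simplex m) k) :
  decode (act h z) = delta_comp (decode z) h.
Proof.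
apply: decode_unique => [i|j f fC i|j f fC i].
- exact: (decode_cut z (h i)).
- exact: (@decode_l _ _ z _ (delta_comp h f) _ i).
- exact: (@decode_r _ _ z _ (delta_comp h f) _ i).
Qed.

Fact shift_homo m n (f : delta m n) :
  {homo (fun i : 'I_m.+4 => inord (if (i < 3)%N then i : nat else 3 + f (inord (i - 3))) : 'I_n.+4)
    : i j / (i <= j)%O}.
Proof.
move=> i j; rewrite !leEord => ij.
have fi := ltn_ord (f (inord (i - 3))); have fj := ltn_ord (f (inord (j - 3))).
have := ltn_ord i; have := ltn_ord j => ? ?.
case: ifP => i3; case: ifP => j3; rewrite !inordK; try lia.
rewrite leq_add2l; apply: (omorph_le f); rewrite leEord !inordK; lia.
Qed.
(** The map that f induces on the joins with the span. *)
Definition shift m n (f : delta m n) : delta m.+3 n.+3 := monotone (shift_homo f).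

Lemma shift_l m n (f : delta m n) (i : 'I_m.+4) : (i < 3)%N -> shift f i = i :> nat.
Proof. by move=> i3; rewrite /= i3 inordK //; lia. Qed.

Lemma shift_r m n (f : delta m n) (i : 'I_m.+4) (j : 'I_m.+1) :
  i = 3 + j :> nat -> shift f i = 3 + f j :> nat.
Proof.
move=> ij; rewrite /= ij ltnNge leq_addr /= addKn inord_val inordK //.
by have := ltn_ord (f j); lia.
Qed.

Lemma shift_ge3 m n (f : delta m n) (i : 'I_m.+4) : (3 <= shift f i)%N = (3 <= i)%N.
Proof.
have [i3|i3] := ltnP i 3; first by rewrite shift_l // leqNgt i3.
have := ltn_ord i => ?.
by rewrite (@shift_r _ _ f _ (inord (i - 3))) // inordK; lia.
Qed.

Lemma shift_comp l m n (f : delta m n) (h : delta l m) :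
  shift (delta_comp f h) = delta_comp (shift f) (shift h).
Proof.
apply: omorphism_ext => i; apply: ord_inj.
have [i3|i3] := ltnP i 3; first by rewrite shift_l // [RHS]shift_l shift_l.
have iE : i = 3 + (inord (i - 3) : 'I_l.+1) :> nat.
  by rewrite inordK; have := ltn_ord i; lia.
by rewrite (shift_r _ iE) [RHS](shift_r _ (shift_r h iE)).
Qed.

Lemma decode_join_map m n k (f : delta m n) (z : join K (simplex m) k) :
  decode (join_map K (simplex_map f) k z) = delta_comp (shift f) (decode z).
Proof.
apply: decode_unique => [i|j g gC i|j g gC i].
- by rewrite [RHS]shift_ge3; exact: (decode_cut z i).
- rewrite [RHS]shift_l; first exact: (@decode_l _ _ z _ g gC i).
  by rewrite -(@decode_l _ _ z _ g gC i).
- by rewrite (@shift_r _ _ f _ ((join_r z j (exist _ g gC) : delta j m) i)) // -decode_r.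
Qed.

Definition vtx_a m : 'I_m.+4 := @Ordinal m.+4 0 isT.
Definition vtx_b m : 'I_m.+4 := @Ordinal m.+4 1 isT.
Definition vtx_c m : 'I_m.+4 := @Ordinal m.+4 2 isT.

Definition no_bc m : face_family m.+3 :=
  fun T => ~~ ((vtx_b m \in T) && (vtx_c m \in T)).

Lemma decode_no_bc m k (z : join K (simplex m) k) : no_bc (image_set (decode z)).
Proof.
apply/negP => /andP[/imsetP[i _ i1] /imsetP[j _ j2]].
have i1' : decode z i = 1 :> nat by rewrite -i1.
have j2' : decode z j = 2 :> nat by rewrite -j2.
have ij : (i <= j)%O.
  rewrite leEord leqNgt; apply/negP => ji.
  have := omorph_le (decode z) (ltnW ji : (j <= i)%O).
  by rewrite leEord i1' j2'.
have iC : join_cut z i = false by rewrite decode_cut i1'.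
have jC : join_cut z j = false by rewrite decode_cut j2'.
have eC : smem (cut_part (join_cut z) false) (edge_map ij : simplex k 1).
  by move=> t; rewrite /= /edge_fun; case: ifP.
have := svalP (join_l z 1 (exist _ _ eC)); rewrite -/(sval _) => -[v v0 vP].
have := decode_l eC ord0; have := decode_l eC ord_max; rewrite /= /edge_fun /= i1' j2' => e2 e1.
case: v v0 vP => [[|[|[|]]] //= v3] _ vP.
  by have /eqP := vP ord0; apply; exact: ord_inj.
by have /eqP := vP ord_max; apply; exact: ord_inj.
Qed.

Fact project_homo m : {homo (fun i : 'I_m.+4 => inord (i - 3) : 'I_m.+1) : i j / (i <= j)%O}.
Proof.
move=> i j; rewrite !leEord => ij; have := ltn_ord i; have := ltn_ord j => ? ?.
by rewrite !inordK; lia.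
Qed.
(** Retracts onto the m-simplex, sending a, b and c to its first vertex. *)
Definition project m : delta m.+3 m := monotone (@project_homo m).

Lemma projectE m (i : 'I_m.+4) : project m i = i - 3 :> nat.
Proof. by rewrite /= inordK //; have := ltn_ord i; lia. Qed.

Lemma project_inj m (x y : 'I_m.+4) : (3 <= x)%N -> (3 <= y)%N ->
  project m x = project m y -> x = y.
Proof.
by move=> x3 y3 xy; apply: ord_inj; rewrite -(subnKC x3) -(subnKC y3) -!projectE xy.
Qed.

Fact truncate_homo m : {homo (fun i : 'I_m.+4 => inord (minn i 2) : 'I_3) : i j / (i <= j)%O}.
Proof. by move=> i j; rewrite !leEord => ij; rewrite !inordK; lia. Qed.
Definition truncate m : delta m.+3 2 := monotone (@truncate_homo m).

Lemma truncateE m (i : 'I_m.+4) : truncate m i = minn i 2 :> nat.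
Proof. by rewrite /= inordK //; lia. Qed.

Section Encode.
Variables (m k : nat) (g : delta k m.+3).

Lemma truncate_horn l (f : delta l k) : no_bc (image_set g) ->
  (forall i, g (f i) < 3)%N ->
  smem (@horn 2 ord0) (delta_comp (truncate m) (delta_comp g f) : simplex 2 l).
Proof.
rewrite /no_bc negb_and => gY gf.
have [v [v0 v3 vP]] : exists v, [/\ 0 < v, v < 3 & forall i, g i != v :> nat]%N.
  case/orP: gY => gv; [exists 1|exists 2]; split=> // i; apply: contra gv => /eqP gi;
  by apply/imsetP; exists i => //; apply: ord_inj; rewrite gi.
exists (Ordinal v3) => [|i]; first by rewrite -val_eqE /= -lt0n.
apply/eqP => /(congr1 (@nat_of_ord _)) /=; rewrite inordK; last by lia.
have := vP (f i); have := gf i; rewrite /=; lia.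
Qed.

Fact encode_cut_homo : {homo (fun i : 'I_k.+1 => 3 <= g i)%N : x y / (x <= y)%O}.
Proof.
move=> i j ij; have := omorph_le g ij; rewrite leEord => gij.
case gi: (3 <= g i)%N; first by rewrite (leq_trans gi gij).
by case: (3 <= g j)%N.
Qed.

Definition encode_cut : {omorphism 'I_k.+1 -> bool} :=
  HB.pack (fun i : 'I_k.+1 => 3 <= g i)%N (Order.isOrderMorphism.Build _ _ _ _ _ encode_cut_homo).

Lemma encode_exists : no_bc (image_set g) -> exists z : join K (simplex m) k, decode z = g.
Proof.
move=> gY.
have part_lt l (f : cut_part encode_cut false l) i : (g ((sval f : delta l k) i) < 3)%N.
  by have := svalP f i => /= /negbT; rewrite -leqNgt.
unshelve epose (jl := @SMap (cut_part encode_cut false) K (fun l f =>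
  exist _ _ (truncate_horn gY (part_lt l f))) _).
  by move=> l j h f; apply: sval_inj; exact: omorphism_ext.
unshelve epose (jr := @SMap (cut_part encode_cut true) (simplex m) (fun l f =>
  delta_comp (project m) (delta_comp g (sval f : delta l k)) : simplex m l) _).
  by move=> l j h f; exact: omorphism_ext.
exists (JoinSimplex jl jr); apply: decode_unique => [//|l f fC j|l f fC j].
  have := part_lt _ (exist _ f fC) j; rewrite truncateE /=; lia.
rewrite projectE; have := fC j; rewrite /=; lia.
Qed.
End Encode.

Definition low3 m : delta 2 m.+3 := table (erefl : is_table 2 m.+3 [:: 0; 1; 2]).

Lemma low3E m (i : 'I_3) : low3 m i = i :> nat.
Proof. by rewrite tableE; case: i => [[|[|[|]]]]. Qed.

Lemma decode_inl m k (x : K k) :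
  decode (join_inl K (simplex m) k x) = delta_comp (low3 m) (sval x : delta k 2).
Proof.
apply: decode_unique => [i|l f fC j|l f fC j].
- by rewrite [X in (3 <= X)%N]low3E leqNgt ltn_ord.
- by rewrite [RHS]low3E.
- by have := fC ord0.
Qed.

Lemma decode_low m k (z : join K (simplex m) k) : (forall i, decode z i < 3)%N ->
  exists x : K k, z = join_inl K (simplex m) k x.
Proof.
move=> z3; have fC : smem (cut_part (join_cut z) false) (delta_id k : simplex k k).
  by move=> i; rewrite decode_cut leqNgt z3.
exists (join_l z k (exist _ _ fC)); apply: decode_inj; rewrite decode_inl.
apply: omorphism_ext => i; apply: ord_inj.
by rewrite [RHS]low3E (decode_l fC).
Qed.

(** The vertices of g from i0 on are those outside the span.  Then g factors through
    the join with the k-simplex: [canonical] keeps the vertices in the span and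
    sends vertex i >= i0 to vertex i of the k-simplex, and the simplex of the right
    hand factor is g made constant before i0, so that it uses no vertex that g does
    not use.  This factorization depends on g only, and every other factorization of
    g is obtained from it by naturality. *)
Section Canonical.
Variables (m k : nat) (g : delta k m.+3) (i0 : 'I_k.+1).
Hypothesis gi0 : forall i, (3 <= g i)%N = (i0 <= i)%N.

Fact from_homo : {homo (fun i : 'I_k.+1 => if (i0 <= i)%N then i else i0) : i j / (i <= j)%O}.
Proof. by move=> i j; rewrite !leEord; case: ifP; case: ifP => //; lia. Qed.
Definition from : delta k k := monotone from_homo.

Fact canonical_homo : {homo (fun i : 'I_k.+1 =>
  inord (if (i0 <= i)%N then 3 + i else g i) : 'I_k.+4) : i j / (i <= j)%O}.
Proof.
move=> i j; rewrite !leEord => ij; have := ltn_ord i; have := ltn_ord j => ? ?.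
have gi := gi0 i; have gj := gi0 j.
have gij : (g i <= g j)%N by exact: (omorph_le g ij).
by case: ifP => iA; case: ifP => jA; rewrite !inordK; lia.
Qed.
Definition canonical : delta k k.+3 := monotone canonical_homo.

Lemma canonicalE i : canonical i = (if (i0 <= i)%N then 3 + i else g i) :> nat.
Proof.
rewrite /= inordK //; have := ltn_ord i => ?; have gi := gi0 i.
by case: ifP => *; lia.
Qed.

Lemma from_ge3 i : (3 <= g (from i))%N.
Proof. by rewrite gi0 /=; case: ifP. Qed.

Lemma canonicalK :
  delta_comp (shift (delta_comp (project m) (delta_comp g from))) canonical = g.
Proof.
apply: omorphism_ext => i; apply: ord_inj; have := canonicalE i; have := gi0 i.
case: ifP => i0i gi cE.
  rewrite (shift_r _ cE) projectE /= i0i; exact: subnKC.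
have gl : (g i < 3)%N by rewrite ltnNge gi.
by rewrite shift_l cE.
Qed.

Lemma canonical_no_bc : no_bc (image_set g) -> no_bc (image_set canonical).
Proof.
have low v : (v < 3)%N -> (exists i, canonical i = v :> nat) -> exists i, g i = v :> nat.
  move=> v3 [i iv]; exists i; move: iv; rewrite canonicalE; case: ifP => // _; lia.
apply: contra => /andP[/imsetP[i _ bi] /imsetP[j _ cj]].
have [|i' gi'] := low 1 isT; first by exists i; rewrite -bi.
have [|j' gj'] := low 2 isT; first by exists j; rewrite -cj.
apply/andP; split; apply/imsetP; [exists i'|exists j'] => //; exact: ord_inj.
Qed.
End Canonical.

(** * Spheres in a coslice under a span *)

(** A sphere s in the coslice under p is the same as a map defined on the join of
    the span with the boundary of a simplex.  The value of this map at g is read off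
    from any way to write g as a simplex z of the join with some face f of the
    boundary. *)
Section Sphere.
Variables (C : sSet) (p : smap K C) (n : nat) (s : smap (boundary n.+1) (coslice p)).

Local Notation N := n.+1.

Definition sphere_value k (g : delta k N.+3) (v : C k) : Prop :=
  exists m (f : boundary N m) (z : join K (simplex m) k),
    g = delta_comp (shift (sval f)) (decode z) /\ v = sval (s m f) k z.

Lemma sphere_value_act k l (h : delta l k) g v :
  sphere_value g v -> sphere_value (delta_comp g h) (act h v).
Proof.
move=> [m [f [z [-> ->]]]]; exists m, f, (act h z); split.
  by rewrite decode_act delta_compA.
by rewrite smap_nat.
Qed.

Lemma first_index k m (g : delta k m.+3) i1 : (3 <= g i1)%N ->
  exists i0 : 'I_k.+1, forall i, (3 <= g i)%N = (i0 <= i)%N.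
Proof.
move=> g1; pose P (i : 'I_k.+1) := (3 <= g i)%N.
have [i0 gi0 i0min] := @arg_minnP _ i1 P (fun i => i : nat) g1.
exists i0 => i; apply/idP/idP; first exact: i0min.
by move=> i0i; apply: (leq_trans gi0); exact: (omorph_le g (i0i : (i0 <= i)%O)).
Qed.

Lemma sphere_value_low k m (f : boundary N m) (z : join K (simplex m) k)
    (x : K k) : (forall i, shift (sval f) (decode z i) = (sval x : delta k 2) i :> nat) ->
  sval (s m f) k z = p k x.
Proof.
move=> zx; have zlow i : (decode z i < 3)%N.
  by rewrite ltnNge -(shift_ge3 (sval f)) zx -ltnNge.
have [y zy] := decode_low zlow.
have -> : x = y.
  apply: sval_inj; apply: omorphism_ext => i; apply: ord_inj.
  by rewrite -zx shift_l // zy decode_inl [LHS]low3E.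
subst z.
exact: (congr1 (fun q : smap K C => q k y) (svalP (s m f))).
Qed.

Lemma sphere_value_high k (g : delta k N.+3) (i0 : 'I_k.+1)
    (gi0 : forall i, (3 <= g i)%N = (i0 <= i)%N) m (f : boundary N m)
    (z : join K (simplex m) k) :
  g = delta_comp (shift (sval f)) (decode z) ->
  forall (w : boundary N k) (zc : join K (simplex k) k),
  sval w = delta_comp (project N) (delta_comp g (from i0)) :> delta k N ->
  decode zc = canonical gi0 ->
  sval (s m f) k z = sval (s k w) k zc.
Proof.
move=> gz w zc wE zcE.
have zi0 i : (3 <= decode z i)%N = (i0 <= i)%N by rewrite -gi0 gz /= -(shift_ge3 (sval f)).
pose u := delta_comp (project m) (delta_comp (decode z) (from i0)).
have uE : delta_comp (shift u) (decode zc) = decode z.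
  rewrite zcE -[RHS](canonicalK zi0); congr delta_comp; apply: omorphism_ext => i.
  apply: ord_inj; rewrite [LHS]canonicalE [RHS]canonicalE; case: ifP => // i0i.
  by rewrite gz [LHS]shift_l // ltnNge zi0 i0i.
have zzc : z = join_map K (simplex_map u) k zc.
  by apply: decode_inj; rewrite decode_join_map uE.
have fuw : act u f = w.
  apply: sval_inj; rewrite [RHS]wE; apply: omorphism_ext => i; apply: ord_inj.
  have fi := from_ge3 zi0 i.
  rewrite [RHS]projectE gz /=.
  rewrite (@shift_r _ _ (sval f : delta m N) _ (project m (decode z (from i0 i)))).
    by rewrite addKn.
  by rewrite projectE subnKC.
by rewrite zzc -fuw smap_nat.
Qed.

Definition sphere_family : face_family N.+3 := fun T =>
  no_bc T && ~~ ([set i : 'I_N.+4 | 3 <= i]%N \subset T).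

Lemma canonical_exists k (g : delta k N.+3) (i0 : 'I_k.+1)
    (gi0 : forall i, (3 <= g i)%N = (i0 <= i)%N) :
  sphere_family (image_set g) ->
  exists (w : boundary N k) (zc : join K (simplex k) k),
    sval w = delta_comp (project N) (delta_comp g (from i0)) :> delta k N /\
    decode zc = canonical gi0.
Proof.
move=> /andP[gY /subsetPn[j]]; rewrite inE => j3 jg.
have [zc zcE] := encode_exists (canonical_no_bc gi0 gY).
have wP : smem (boundary N) (delta_comp (project N) (delta_comp g (from i0)) : simplex N k).
  exists (project N j) => i; apply: contraNneq jg => gj.
  have <- : g (from i0 i) = j by apply: project_inj gj => //; exact: from_ge3.
  exact: mem_image_set.
by exists (exist _ _ wP), zc.
Qed.

Lemma sphere_value_family k (g : delta k N.+3) v :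
  sphere_value g v -> sphere_family (image_set g).
Proof.
move=> [m [f [z [-> _]]]]; apply/andP; split.
  apply: contra (decode_no_bc z) => /andP[/imsetP[i _ bi] /imsetP[j _ cj]].
  have low (x : 'I_m.+4) c : (c < 3)%N -> shift (sval f) x = c :> nat -> x = c :> nat.
    move=> c3 xc; have x3 : (x < 3)%N by rewrite ltnNge -(shift_ge3 (sval f)) xc -ltnNge.
    by rewrite -xc shift_l.
  apply/andP; split; apply/imsetP; [exists i|exists j] => //; apply/esym/ord_inj.
    by apply: low => //; rewrite /= in bi *; rewrite -bi.
  by apply: low => //; rewrite /= in cj *; rewrite -cj.
have [j fj] := svalP f.
apply/subsetPn; exists (inord (3 + j)); first by rewrite inE inordK //; have := ltn_ord j; lia.
apply/imsetP => -[i _ /(congr1 (@nat_of_ord _))].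
rewrite inordK; last by have := ltn_ord j; lia.
move=> ji; have zi : (3 <= decode z i)%N by
    rewrite -(shift_ge3 (sval f)) -[shift _ _]/(delta_comp (shift (sval f)) (decode z) i) -ji.
have ziE : decode z i = 3 + (project m (decode z i)) :> nat by rewrite projectE subnKC.
move: ji; rewrite [RHS](shift_r _ ziE) => /addnI/ord_inj/esym/eqP; exact/negP/fj.
Qed.

(** If g lies in the span, its value is given by p; otherwise every factorization of
    g is compared with the canonical one. *)
Lemma sphere_value_functional k (g : delta k N.+3) v v' :
  sphere_value g v -> sphere_value g v' -> v = v'.
Proof.
move=> gv; have gX := sphere_value_family gv.
move: gv => [m [f [z [gz ->]]]] [m' [f' [z' [gz' ->]]]].
have [/existsP[i1 gi1]|/existsPn glow] := boolP [exists i, 3 <= g i]%N.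
  have [i0 gi0] := first_index gi1.
  have [w [zc [wE zcE]]] := canonical_exists gi0 gX.
  by rewrite (sphere_value_high gz wE zcE) (sphere_value_high gz' wE zcE).
have zlow i : (decode z i < 3)%N.
  by rewrite ltnNge -(shift_ge3 (sval f)); have := glow i; rewrite gz.
have [x zx] := decode_low zlow.
have gx i : g i = (sval x : delta k 2) i :> nat.
  by rewrite gz [LHS]shift_l // zx decode_inl [LHS]low3E.
rewrite (@sphere_value_low _ _ f z x); last by move=> i; rewrite -gx gz.
by rewrite (@sphere_value_low _ _ f' z' x) // => i; rewrite -gx gz'.
Qed.

Lemma sphere_value_total k (g : delta k N.+3) :
  sphere_family (image_set g) -> exists v, sphere_value g v.
Proof.
move=> gX; have [/existsP[i1 gi1]|/existsPn glow] := boolP [exists i, 3 <= g i]%N.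
  have [i0 gi0] := first_index gi1.
  have [w [zc [wE zcE]]] := canonical_exists gi0 gX.
  exists (sval (s k w) k zc), k, w, zc; split=> //.
  by rewrite zcE [sval w]wE canonicalK.
have [gY _] := andP gX.
have gf i : (g (delta_id k i) < 3)%N by rewrite ltnNge glow.
pose x : K k := exist _ _ (truncate_horn gY gf).
pose f : boundary N 0 := boundary_vertex ord0.
exists (sval (s 0 f) k (join_inl K (simplex 0) k x)), 0, f, (join_inl K (simplex 0) k x).
split=> //; apply: omorphism_ext => i; apply: ord_inj; rewrite decode_inl.
have xE : low3 0 ((sval x : delta k 2) i) = g i :> nat.
  by have gi := gf i; rewrite low3E [LHS]truncateE; apply/minn_idPl; rewrite -ltnS.
by rewrite [RHS]shift_l xE // ltnNge glow.
Qed.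

Lemma sphere_total_map (x0 : C 0) : exists a : total_map N.+3 C,
  simplicial_on sphere_family a /\
  forall k m (f : boundary N m) (z : join K (simplex m) k),
    a k (delta_comp (shift (sval f)) (decode z)) = sval (s m f) k z.
Proof.
pose a k (g : delta k N.+3) : C k := match pselect (exists v, sphere_value g v) with
  | left ex => projT1 (cid ex) | right _ => act (degen_map k) x0 end.
have aP k (g : delta k N.+3) v : sphere_value g v -> a k g = v.
  move=> gv; rewrite /a; case: pselect => [ex|[]]; last by exists v.
  by case: cid => v' gv' /=; exact: sphere_value_functional gv' gv.
exists a; split=> [k m h g gX|k m f z].
  have [v gv] := sphere_value_total gX.
  by rewrite (aP _ _ _ gv) (aP _ _ _ (sphere_value_act h gv)).
by apply: aP; exists m, f, z.
Qed.

End Sphere.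

(** * Squares with two opposite degenerate edges *)

Lemma degenerate_on_agree M C (A : face_family M) (T : {set 'I_M.+1}) x (a b : total_map M C) :
  down_closed A -> A T -> agree_on A b a -> degenerate_on T x a -> degenerate_on T x b.
Proof. by move=> Acl AT ba ax m f fT; rewrite ba ?ax //; exact: Acl AT. Qed.

(** The last step in the extension of a cocone: [a_bd] and [a_ac] say that the edges
    b -> d and a -> c are degenerate, where d is the vertex v3 at which the simplex
    P on the remaining vertices starts.  The faces still missing are those that
    contain P; they are attached as P and bP, then aP and abP, then cP and acP. *)
Section CellsOfTheCocone.
Variables (C : sSet) (hC : is_quasicategory C) (x y : C 0) (n : nat).
Local Notation N := n.+1.
Variable a : total_map N.+3 C.
Hypothesis aP : simplicial_on (@sphere_family n) a.

Let va := vtx_a N.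
Let vb := vtx_b N.
Let vc := vtx_c N.
Let v3 : 'I_N.+4 := @Ordinal N.+4 3 isT.
Let v4 : 'I_N.+4 := @Ordinal N.+4 4 isT.
Let P : {set 'I_N.+4} := [set i : 'I_N.+4 | 3 <= i]%N.

Hypothesis a_bd : degenerate_on [set vb; v3] y a.
Hypothesis a_ac : degenerate_on [set va; vc] x a.

Let X := @sphere_family n.
Let T1 := vb |: P.
Let T2 := va |: (vb |: P).
Let T3 := va |: (vc |: P).
Let A1 (T : {set 'I_N.+4}) := X T || (T \subset T1).
Let A2 (T : {set 'I_N.+4}) := A1 T || (T \subset T2).

Let sub_closed (S : {set 'I_N.+4}) : down_closed (fun T : {set 'I_N.+4} => T \subset S).
Proof. by move=> T T' /subset_trans TT' /TT'. Qed.

Let X_closed : down_closed X.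
Proof.
move=> S T ST /andP[TY PT]; apply/andP; split.
  by apply: contra TY => /andP[Sb Sc]; rewrite !(subsetP ST).
by apply: contra PT => /subset_trans; exact.
Qed.

Let A1_closed : down_closed A1. Proof. exact: down_closedU. Qed.
Let A2_closed : down_closed A2. Proof. exact: down_closedU. Qed.

Let X_del (T : {set 'I_N.+4}) t : t \in P -> ~~ ((vb \in T) && (vc \in T)) -> X (T :\ t).
Proof.
move=> tP TY; apply/andP; split.
  by apply: contra TY; rewrite !inE => /andP[/andP[_ ->] /andP[_ ->]].
by apply/subsetPn; exists t => //; rewrite !inE eqxx.
Qed.

Let not_X (T : {set 'I_N.+4}) : P \subset T -> ~~ X T.
Proof. by move=> PT; rewrite /X /sphere_family PT andbF. Qed.

Let PD1 (v : 'I_N.+4) (T : {set 'I_N.+4}) : (v < 3)%N -> P \subset T -> P \subset T :\ v.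
Proof.
move=> vlt /subsetP PT; apply/subsetP => t tP; rewrite !inE PT // andbT.
by apply: contraTneq tP => ->; rewrite inE -ltnNge.
Qed.

Let PT (v w : 'I_N.+4) : P \subset v |: (w |: P).
Proof. by apply/subsetP => t tP; rewrite !in_setU1 tP !orbT. Qed.

Lemma cocone_extends : extends X (@no_bc N) a.
Proof.
have e1 : extends X A1 a.
  apply: (@outer_cell_extends _ _ _ _ vb v3 v4 y) => //.
  - by rewrite !inE.
  - by rewrite !inE.
  - by rewrite !inE.
  - by move=> t; rewrite !inE => /predU1P[->|]; [left|right].
  - by apply/not_X/PD1 => //; exact: subsetUr.
  - move=> t; rewrite in_setU1 => /predU1P[->|tP _]; first by rewrite eqxx.
    by apply: X_del => //; rewrite !inE andbF.
have [b [bP ba]] : extends X A2 a.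
  apply: extends_trans e1 _ => [T|b bP _]; first by rewrite /A1 => ->.
  apply: (inner_cell_extends (v := vb)) => //.
  - by rewrite !inE.
  - by apply/andP; split; apply/existsP; [exists va|exists v3]; rewrite !inE.
  - have XT : ~~ X (T2 :\ vb) by apply/not_X/PD1 => //; exact: PT.
    by rewrite /A1 negb_or XT; apply/subsetPn; exists va; rewrite !inE.
  - move=> t; rewrite 2!in_setU1 => /or3P[/eqP -> _|/eqP ->|tP _].
    + apply/orP; right; apply/subsetP => t'; rewrite !inE.
      by case/andP => /negbTE -> /=.
    + by rewrite eqxx.
    + by apply/orP; left; apply: X_del => //; rewrite !inE andbF.
have b_ac : degenerate_on [set va; vc] x b.
  apply: degenerate_on_agree ba a_ac; first exact: X_closed.
  apply/andP; split; first by rewrite /no_bc !inE.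
  by apply/subsetPn; exists v3; rewrite !inE.
have [c [cP cb]] : extends A2 (fun T => A2 T || (T \subset T3)) b.
  apply: (@outer_cell_extends _ _ _ _ va vc v3 x) => //.
  - by rewrite !inE.
  - by rewrite !inE.
  - by rewrite !inE.
  - by move=> t; rewrite !inE => /predU1P[->|/predU1P[->|t3]]; [left|right|right; exact: ltnW].
  - have XT : ~~ X (T3 :\ va) by apply/not_X/PD1 => //; exact: PT.
    by rewrite /A2 /A1 !negb_or XT; apply/andP; split; apply/subsetPn; exists vc; rewrite !inE.
  - move=> t; rewrite 2!in_setU1 => /or3P[/eqP ->|/eqP -> _|tP _].
    + by rewrite eqxx.
    + apply/orP; right; apply/subsetP => t'; rewrite !inE.
      by case/andP => /negbTE -> /= /orP[->|->]; rewrite ?orbT.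
    + by apply/orP; left; apply/orP; left; apply: X_del => //; rewrite !inE.
exists c; split; last by move=> m f Xf; rewrite cb ?ba // /A2 /A1 Xf.
apply: simplicial_on_sub cP => T TY.
have [_|nPT] := boolP (P \subset T); last by rewrite /A2 /A1 /X /sphere_family TY nPT.
have TE t : [|| t == va, t == vb, t == vc | t \in P].
  by rewrite inE -!val_eqE /=; case: (t : nat) => [|[|[|]]].
have [Tb|Tb] := boolP (vb \in T).
  have Tc : vc \notin T by move: TY; rewrite /no_bc Tb.
  apply/orP; left; apply/orP; right; apply/subsetP => t tT; rewrite 2!in_setU1.
  by have := TE t; rewrite (_ : t == vc = false) //; apply: contraNF Tc => /eqP <-.
apply/orP; right; apply/subsetP => t tT; rewrite 2!in_setU1.
by have := TE t; rewrite (_ : t == vb = false) //; apply: contraNF Tb => /eqP <-.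
Qed.

End CellsOfTheCocone.

(** A square in which the edges a -> c and b -> d are degenerate is a pushout.
    The square is a map sq on the simplex a < b < c < d without the faces that
    contain both b and c, and q is the corresponding cocone. *)
Section SquareInitial.
Variables (C : sSet) (hC : is_quasicategory C) (x y : C 0) (sq : total_map 3 C).
Hypotheses (sq_ac : degenerate_on [set t3_0; t3_2] x sq)
  (sq_bd : degenerate_on [set t3_1; t3_3] y sq).
Variables (p : smap K C) (q : coslice p 0).
Hypothesis qE : forall k (z : join K (simplex 0) k), sval q k z = sq (decode z).

Fact clip_homo m : {homo (fun i : 'I_m.+4 => inord (minn i 3) : 'I_4) : i j / (i <= j)%O}.
Proof. by move=> i j; rewrite !leEord => ij; rewrite !inordK; lia. Qed.
Definition clip m : delta m.+3 3 := monotone (@clip_homo m).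

Lemma clipE m (i : 'I_m.+4) : clip m i = minn i 3 :> nat.
Proof. by rewrite /= inordK //; lia. Qed.

(** The first vertex of the sphere is q, hence the map on the join has the values
    of sq on simplices with vertices a, b, c and 3; [clip] collapses the others
    onto 3. *)
Lemma square_is_colimit : is_colimit q.
Proof.
move=> n s s0; have [a [aP aE]] := sphere_total_map s x.
have a_sq m (f : delta m n.+4) : (forall i, f i <= 3)%N -> no_bc (image_set f) ->
    a m f = sq (delta_comp (clip n.+1) f).
  move=> f3 fY.
  have cE i : clip n.+1 (f i) = f i :> nat by rewrite clipE; exact/minn_idPl.
  have [|z zE] := @encode_exists 0 m (delta_comp (clip n.+1) f).
    apply: contra fY => /andP[/imsetP[i _ bi] /imsetP[j _ cj]].
    apply/andP; split; apply/imsetP; [exists i|exists j] => //; apply: ord_inj;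
      by rewrite -cE -[clip _ _]/(delta_comp (clip n.+1) f _) -?bi -?cj.
  rewrite -zE -qE -s0 -aE zE; congr a; apply: omorphism_ext => i; apply: ord_inj.
  have := cE i; have := f3 i; rewrite leq_eqVlt => /orP[/eqP fi ci|fi ci].
    by rewrite (@shift_r _ _ _ _ (ord0 : 'I_1)) ?ci ?fi.
  by rewrite shift_l ci.
have a_deg m (f : delta m n.+4) (u v : 'I_n.+1.+4) (u' v' : 'I_4) z :
    u = u' :> nat -> v = v' :> nat ->
    ~~ ((vtx_b n.+1 \in [set u; v]) && (vtx_c n.+1 \in [set u; v])) ->
    degenerate_on [set u'; v'] z sq -> image_set f \subset [set u; v] ->
    a m f = act (degen_map m) z.
  move=> uu' vv' uvY sqz /[dup] fS /image_setP fuv; rewrite a_sq.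
  - apply: sqz; apply/image_setP => i; have := fuv i; rewrite !inE -!val_eqE.
    rewrite [val (delta_comp _ _ _)]clipE /= uu' vv'.
    by case/orP => /eqP ->; have := ltn_ord u'; have := ltn_ord v'; lia.
  - move=> i; have := fuv i; rewrite !inE => /orP[] /eqP ->; rewrite ?uu' ?vv' -ltnS; exact: ltn_ord.
  - by apply: contra uvY => /andP[? ?]; rewrite !(subsetP fS).
have [b [bP ba]] : extends (@sphere_family n) (@no_bc n.+1) a.
  apply: (@cocone_extends C hC x y) => // m f.
    by apply: (@a_deg _ _ _ _ t3_1 t3_3) => //; rewrite !inE.
  by apply: (@a_deg _ _ _ _ t3_0 t3_2) => //; rewrite !inE.
have shift_no_bc m k (f : delta m n.+1) (z : join K (simplex m) k) :
    no_bc (image_set (delta_comp (shift f) (decode z))).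
  by rewrite -decode_join_map; exact: decode_no_bc.
have b_s k m (f : boundary n.+1 m) (z : join K (simplex m) k) :
    b k (delta_comp (shift (sval f)) (decode z)) = sval (s m f) k z.
  by rewrite ba ?aE //; apply: (@sphere_value_family _ _ _ s); exists m, f, z.
unshelve epose (tq m (f : simplex n.+1 m) := @SMap (join K (simplex m)) C
   (fun k z => b k (delta_comp (shift (f : delta m n.+1)) (decode z))) _).
  by move=> k l h z /=; rewrite decode_act delta_compA bP.
have tqP m f : smap_comp (@tq m f) (join_inl K (simplex m)) = p.
  apply: smap_ext => k v /=.
  have -> : delta_comp (shift f) (decode (join_inl K (simplex m) k v)) =
      delta_comp (shift (sval (boundary_vertex ord0 : boundary n.+1 0)))
        (decode (join_inl K (simplex 0) k v)).
    apply: omorphism_ext => i; apply: ord_inj; rewrite !decode_inl.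
    have low w j (u : K j) i' : (delta_comp (low3 w) (sval u : delta j 2) i' < 3)%N.
      by rewrite [X in (X < _)%N]low3E ltn_ord.
    by rewrite [LHS]shift_l ?[RHS]shift_l ?low // [LHS]low3E [RHS]low3E.
  apply: etrans (b_s _ _ (boundary_vertex ord0 : boundary n.+1 0) _) _.
  by rewrite s0; exact: (congr1 (fun u : smap K C => u k v) (svalP q)).
unshelve epose (t := @SMap (simplex n.+1) (coslice p) (fun m f => exist _ (tq m f) (tqP m f)) _).
  move=> k m h f; apply: sval_inj; apply: smap_ext => l z /=.
  by rewrite decode_join_map delta_compA -shift_comp.
exists t; apply: smap_ext => m f; apply: sval_inj; apply: smap_ext => k z /=.
exact: b_s.
Qed.
End SquareInitial.

(** * A homotopic edge is a pushout *)

(** The square consists of the triangle abd that witnesses the homotopy, with edges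
    e', degenerate, and e, and of the triangle acd degenerate on e. *)
Section HomotopySquare.
Variables (C : sSet) (hC : is_quasicategory C) (x y : C 0) (e' e : edge C x y).
Hypothesis e'e : homotopic e' e.

Let r_ac : delta 3 1 := table (erefl : is_table 3 1 [:: 0; 0; 0; 1]).

Let square_exists : exists (sq : total_map 3 C) (t : C 2),
  [/\ [/\ act e01 t = e', act e12 t = degen_edge y & act e02 t = e],
      simplicial_on (@no_bc 0) sq,
      agree_on (avoids t3_2) sq (fun m f => act (delta_comp r013 f) t)
    & agree_on (avoids t3_1) sq (fun m f => act (delta_comp r_ac f) (e : C 1))].
Proof.
have /is_triangleE[t [t01 t12 t02]] := e'e.
have [|sq [sqP sq2 sq1]] := glue (@avoids_closed _ t3_2) (@avoids_closed _ t3_1)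
    (act_simplicial r013 t) (act_simplicial r_ac (e : C 1)).
  move=> m f /avoidsP f2 /avoidsP f1.
  apply: (act_agree (t := r_ac) (d := e02) (d' := delta_id 1)).
  - move=> i; move: (f i) (f1 i) (f2 i); case=> [[|[|[|[|]]]] // ?] // _ _;
      by apply: ord_inj; rewrite !tableE.
  - by [].
  - by rewrite t02 act_id.
exists sq, t; split=> //; apply: simplicial_on_sub sqP => T; rewrite /no_bc negb_and orbC.
by congr orb; congr (~~ (_ \in _)); exact: ord_inj.
Qed.

Lemma homotopic_pushout : is_pushout e' (degen_edge x) e.
Proof.
have [sq [t [[t01 t12 t02] sqP sq2 sq1]]] := square_exists.
unshelve epose (Q := @SMap (join K (simplex 0)) C (fun k z => sq k (decode z)) _).
  by move=> k l h z /=; rewrite decode_act sqP //; exact: decode_no_bc.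
pose p := smap_comp Q (join_inl K (simplex 0)).
pose q : coslice p 0 := exist _ Q erefl.
have pE k (v : K k) : p k v = sq k (delta_comp (low3 0) (sval v : delta k 2)).
  by rewrite /p /= decode_inl.
exists p, q; split.
- rewrite pE sq2; last by apply/avoidsP => -[[|[|]] // ?];
    apply/eqP => /(congr1 (@nat_of_ord _)); rewrite low3E.
  rewrite -t01; congr act; apply: omorphism_ext => -[[|[|]] // ?]; apply: ord_inj;
    by rewrite !tableE.
- rewrite pE sq1; last by apply/avoidsP => -[[|[|]] // ?];
    apply/eqP => /(congr1 (@nat_of_ord _)); rewrite low3E.
  transitivity (act (delta_comp (vertex_map ord0) (degen_map 1)) (e : C 1)).
    congr act; apply: omorphism_ext => -[[|[|]] // ?]; apply: ord_inj;
    by rewrite !tableE.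
  by rewrite act_comp -/(vertex _ _) -/(src _) edge_src.
- apply: (@square_is_colimit C hC x y sq) => //.
    move=> m f /image_setP f02.
    have f1 : avoids t3_1 (image_set f).
      by apply/avoidsP => i; have := f02 i; rewrite !inE => /orP[] /eqP ->.
    rewrite sq1 //; transitivity (act (delta_comp (vertex_map ord0) (degen_map m)) (e : C 1)).
      congr act; apply: omorphism_ext => i; apply: ord_inj; rewrite tableE //.
      by have := f02 i; rewrite !inE => /orP[] /eqP ->.
    by rewrite act_comp -/(vertex _ _) -/(src _) edge_src.
  move=> m f /image_setP f13.
  have f2 : avoids t3_2 (image_set f).
    by apply/avoidsP => i; have := f13 i; rewrite !inE => /orP[] /eqP ->.
  rewrite sq2 //.
  have -> : delta_comp r013 f = delta_comp e12 (delta_comp r_ac f).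
    apply: omorphism_ext => i; apply: ord_inj; rewrite !tableE //.
    by have := f13 i; rewrite !inE => /orP[] /eqP ->.
  rewrite act_comp t12 /= -act_comp; congr act; exact: omorphism_ext.
- rewrite /q /=.
  have -> : decode (join_edge span_vertex2 (delta_id 0 : simplex 0 0)) =
    table (erefl : is_table 1 3 [:: 2; 3]).
    apply: decode_unique => [i|l f fC j|l f fC j].
    + by rewrite tableE; case: i => [[|[|]]].
    + have := fC j; rewrite /= => /negbT; rewrite negbK => /eqP ->; by rewrite inordK.
    + have := fC j; rewrite tableE /=. by case: (f j) => [[|[|]]].
  rewrite sq1; last by apply/avoidsP => -[[|[|]] // ?];
    apply/eqP => /(congr1 (@nat_of_ord _)); rewrite tableE.
  rewrite -[RHS]act_id; congr act; apply: omorphism_ext => -[[|[|]] // ?]; apply: ord_inj;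
  by rewrite !tableE.
Qed.
End HomotopySquare.

(** * Subcategories of a quasicategory *)

Lemma edge_map_of n (u : delta 1 n) :
  exists (i j : 'I_n.+1) (ij : (i <= j)%O), u = edge_map ij.
Proof.
have ij : (u ord0 <= u ord_max)%O by exact: omorph_le.
exists (u ord0), (u ord_max), ij; apply: omorphism_ext => t.
rewrite /= /edge_fun; case: eqP => [-> //|/eqP t0]; congr (u _); apply: ord_inj.
by case: t t0 => [[|[|]]].
Qed.

Definition yoneda (X : sSet) n (s : X n) : smap (simplex n) X :=
  @SMap (simplex n) X (fun m f => act f s) (fun _ _ h f => act_comp h f s).

Lemma one_full_edges (X : sSet) (A : ssubset X) : one_full A ->
  forall n (s : X n),
  (forall (i j : 'I_n.+1) (ij : (i <= j)%O), smem A (act (edge_map ij) s)) ->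
  smem A s.
Proof.
move=> A1 n s sA; apply/A1 => u; have [i [j [ij ->]]] := edge_map_of u; exact: sA.
Qed.

Lemma arr_is_iso (D : category) (a b a' b' : D) (f : hom a b) (f' : hom a' b') :
  arr f = arr f' -> is_iso f -> is_iso f'.
Proof.
move=> ff'; have P (k k' : arrow D) : k = k' -> is_iso (projT2 (projT2 k)) ->
  is_iso (projT2 (projT2 k')) by move=> ->.
exact: (P _ _ ff').
Qed.

Lemma idm_iso (D : category) (a : D) : is_iso (idm a).
Proof. by exists (idm a); rewrite comp1m. Qed.

Lemma degenerate_equivalence (X : sSet) (x : X 0) : is_equivalence (degen_edge x).
Proof.
apply: (arr_is_iso (f := @idm (tau1 X) x)); last exact: idm_iso.
by rewrite -(tau1_edge_id (e := degen_edge x)) //; exact: arr_tau1_edge.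
Qed.

(** An operator from the 1-simplex to itself is the identity or constant. *)
Lemma core_edge (X : sSet) (e : X 1) : is_equivalence e -> smem (core X) e.
Proof.
have ord2 (t : 'I_2) : t = ord0 \/ t = ord_max.
  by case: t => [[|[|]] // ?]; [left|right]; exact: ord_inj.
move=> eE u; have [u01|nu] := eqVneq (u ord0) (u ord_max).
  have -> : act u e = degen_edge (vertex e (u ord0)).
    rewrite /= /vertex -act_comp; congr act; apply: omorphism_ext => t /=.
    by have [->|->] := ord2 t.
  exact: degenerate_equivalence.
have -> : u = delta_id 1; last by rewrite act_id.
have ule : (u ord0 <= u ord_max)%O by exact: omorph_le.
apply: omorphism_ext => t /=.
by have [->|->] := ord2 t; move: nu ule; have [->|->] := ord2 (u ord0);
  have [->|->] := ord2 (u ord_max).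
Qed.

Lemma sub_hom_arr (D : category) (A : subcategory D) (a b a' b' : D)
    (f : hom a b) (f' : hom a' b') : arr f = arr f' -> sub_hom A f -> sub_hom A f'.
Proof.
move=> ff'; have P (k k' : arrow D) : k = k' -> sub_hom A (projT2 (projT2 k)) ->
  sub_hom A (projT2 (projT2 k')) by move=> ->.
exact: (P _ _ ff').
Qed.

(** For the converse inclusion, the universal property is applied to the map out of
    the n-simplex that corresponds to s. *)
Lemma pullback_mem (C : sSet) (D : ssubset C) (A : subcategory (tau1 C))
    (l : smap D (nerve A)) :
  is_pullback (ssub_incl D) l (tau1_unit C) (nerve_map (subcat_incl A)) ->
  forall n (s : C n), smem D s <->
  forall (i j : 'I_n.+1) (ij : (i <= j)%O), sub_hom A (tau1_edge (face_edge s ij)).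
Proof.
move=> [sq univ] n s; split=> [sD i j ij|sA].
  have := congr1 (fun u : smap D _ => u n (exist _ s sD)) sq => /= sE.
  have := congr1 (fun F : functor (ordcat n) (tau1 C) => arr (@fhom (ordcat n) _ F i j ij)) sE.
  rewrite /= => aE.
  apply: sub_hom_arr (esym aE) _; exact: (svalP (@fhom (ordcat n) _ (l n (exist _ s sD)) i j ij)).
have obA i : sub_ob A (vertex s i) := sub_hom_src (sA i i (lexx i)).
unshelve epose (F0 := @Functor (ordcat n) A (fun i => exist _ (vertex s i) (obA i))
  (fun i j ij => exist _ (tau1_edge (face_edge s ij)) (sA i j ij)) _ _).
- by move=> i; apply: sval_inj; exact: (fhom_id (tau1_unit_functor s) i).
- by move=> i j k jk ij; apply: sval_inj; exact: (fhom_comp (tau1_unit_functor s) jk ij).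
have [|z [[zx zy] _]] := univ _ (yoneda s) (yoneda (F0 : nerve A n)).
  apply: smap_ext => m f.
  apply: etrans (smap_nat (tau1_unit C) f s) _.
  apply: etrans (esym (smap_nat (nerve_map (subcat_incl A)) f (F0 : nerve A n))).
  by congr act; apply: functor_ext.
have := congr1 (fun u : smap (simplex n) C => u n (delta_id n)) zx; rewrite /= act_id => <-.
exact: svalP.
Qed.

Lemma subcat_incl_mono (D E : category) (A : subcategory E) (F G : functor D A) :
  functor_comp (subcat_incl A) F = functor_comp (subcat_incl A) G -> F = G.
Proof.
move=> FG; apply: functor_ext => a b f.
have aE := congr1 (fun H : functor D E => arr (fhom H f)) FG.
have P (a1 b1 a2 b2 : A) (f1 : hom a1 b1) (f2 : hom a2 b2) :
    arr (fhom (subcat_incl A) f1) = arr (fhom (subcat_incl A) f2) -> arr f1 = arr f2.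
  case: a1 b1 a2 b2 f1 f2 => [a1 a1A] [b1 b1A] [a2 a2A] [b2 b2A] [f1 f1A] [f2 f2A] /= ff.
  have Q (k k' : arrow E) : k = k' ->
      forall (k1 : sub_ob A (projT1 k)) (k2 : sub_ob A (projT1 (projT2 k)))
        (k3 : sub_hom A (projT2 (projT2 k)))
        (k1' : sub_ob A (projT1 k')) (k2' : sub_ob A (projT1 (projT2 k')))
        (k3' : sub_hom A (projT2 (projT2 k'))),
      @arr A (exist _ _ k1) (exist _ _ k2) (exist _ _ k3) =
      @arr A (exist _ _ k1') (exist _ _ k2') (exist _ _ k3').
    move=> <- k1 k2 k3 k1' k2' k3'.
    by rewrite (Prop_irrelevance k1' k1) (Prop_irrelevance k2' k2) (Prop_irrelevance k3' k3).
  exact: (Q _ _ ff).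
exact: P aE.
Qed.

Lemma edge_map01 : edge_map (isT : (ord0 <= ord_max :> 'I_2)%O) = delta_id 1.
Proof.
apply: omorphism_ext => t; rewrite /= /edge_fun; case: eqP => [-> //|/eqP t0].
by apply: ord_inj; case: t t0 => [[|[|]]].
Qed.

Section Subcategory.
Variables (C : sSet) (hC : is_quasicategory C) (D : ssubset C).

Section FromSubcategory.
Variable A : subcategory (tau1 C).
Hypothesis memD : forall n (s : C n), smem D s <->
  forall (i j : 'I_n.+1) (ij : (i <= j)%O), sub_hom A (tau1_edge (face_edge s ij)).

Lemma face_in_subcategory n (s : C n) (i j : 'I_n.+1) (ij : (i <= j)%O) :
  smem D (act (edge_map ij) s) -> sub_hom A (tau1_edge (face_edge s ij)).
Proof.
move=> /memD/(_ ord0 ord_max isT); apply: sub_hom_arr; apply: arr_tau1_edge => /=.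
by rewrite edge_map01 act_id.
Qed.

Lemma subcategory_one_full : one_full D.
Proof.
move=> n s; split=> [sD u|sD]; first exact: smem_act.
by apply/memD => i j ij; exact: face_in_subcategory.
Qed.

(** The filler is taken in C.  An edge ij of it belongs to the horn at k if some
    vertex other than k, i and j exists.  Otherwise i and j are the first and the last
    vertex, and the edge ij is a composite of ik and kj, which belong to the horn. *)
Lemma subcategory_quasicategory : is_quasicategory D.
Proof.
move=> n k hk h; have [s sh] := hC hk (smap_comp (ssub_incl D) h).
have shE m (f : horn k m) : s m (sval f) = sval (h m f).
  exact: (congr1 (fun u : smap (horn k) C => u m f) sh).
pose t := s n (delta_id n).
have tE m (f : delta m n) : act f t = s m f.
  by rewrite -smap_nat; congr (s m); exact: omorphism_ext.
have edgeD (i j v : 'I_n.+1) (ij : (i <= j)%O) : v != k -> i != v -> j != v ->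
    sub_hom A (tau1_edge (face_edge t ij)).
  move=> vk iv jv; apply: face_in_subcategory; rewrite tE.
  have eP : smem (horn k) (edge_map ij : simplex n 1).
    by exists v => // w; rewrite /= /edge_fun; case: ifP.
  by have := shE 1 (exist _ _ eP) => /= ->; exact: svalP.
have tD : smem D t.
  apply/memD => i j ij; move: hk => /andP[k0 kn].
  have [/existsP[v /and3P[vk iv jv]]|/existsPn noV] :=
    boolP [exists v, [&& v != k, i != v & j != v]]; first exact: edgeD iv jv.
  have ik : (i < k)%N.
    have := noV ord0; rewrite -!val_eqE /= !negb_and !negbK; rewrite leEord in ij.
    by case/or3P => /eqP; lia.
  have kj : (k < j)%N.
    have := noV ord_max; rewrite -!val_eqE /= !negb_and !negbK; rewrite leEord in ij.
    have jlt := ltn_ord j; by case/or3P => /eqP; lia.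
  have ik' : (i <= k)%O by rewrite leEord ltnW.
  have kj' : (k <= j)%O by rewrite leEord ltnW.
  rewrite (tau1_edge_comp (face_edge_triangle t ik' kj' ij)).
  apply: sub_hom_comp; [apply: (edgeD _ _ i)|apply: (edgeD _ _ j)];
    by rewrite -?val_eqE /=; lia.
exists (yoneda (exist _ t tD : D n)); apply: smap_ext => m f;
apply: sval_inj; rewrite -shE /=; exact: tE.
Qed.
End FromSubcategory.

Section ToSubcategory.
Hypotheses (D_qcat : is_quasicategory D) (D1 : one_full D).
Hypothesis D_eq : forall f : C 1, is_equivalence f -> smem D f.
Hypothesis D_htpy : forall (x y : C 0) (e' e : edge C x y),
  homotopic e' e -> smem D (e' : C 1) -> smem D (e : C 1).

(** Closed under composition because D itself has composites: it matters that the
    triangle can be chosen in D, as its long edge represents the composite. *)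
Definition edge_subcategory : subcategory (tau1 C).
Proof.
exists (fun _ => True)
  (fun x y f => exists2 e : edge C x y, smem D (e : C 1) & f = tau1_edge e) => //.
- move=> x _; exists (degen_edge x); last exact/esym/tau1_edge_id.
  exact/D_eq/degenerate_equivalence.
- move=> x y z _ _ [g gD ->] [f fD ->].
  pose f' : D 1 := exist _ _ fD; pose g' : D 1 := exist _ _ gD.
  have fg : src g' = tgt f' by apply: sval_inj; exact: etrans (edge_src g) (esym (edge_tgt f)).
  have [h [t [tf tg th]]] := composite_exists D_qcat (Edge erefl erefl : edge D (src f') (tgt f'))
    (Edge fg erefl : edge D (tgt f') (tgt g')).
  have hx : src (sval (h : D 1)) = x.
    exact: etrans (congr1 sval (edge_src h)) (edge_src f).
  have hz : tgt (sval (h : D 1)) = z.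
    exact: etrans (congr1 sval (edge_tgt h)) (edge_tgt g).
  exists (Edge hx hz); first exact: svalP.
  apply/esym/tau1_edge_comp; exists (sval t); split.
  + exact: (congr1 sval tf).
  + exact: (congr1 sval tg).
  + exact: (congr1 sval th).
Defined.

Lemma edge_in_subcategory x y (e : edge C x y) :
  sub_hom edge_subcategory (tau1_edge e) -> smem D (e : C 1).
Proof. by move=> [e' e'D /esym/(tau1_edge_homotopic hC) e'e]; exact: D_htpy e'D. Qed.

Definition to_edge_subcategory_at n (s : D n) : nerve edge_subcategory n.
Proof.
unshelve eexists.
- by move=> i; exists (vertex (sval s) i).
- move=> i j ij; exists (tau1_edge (face_edge (sval s) ij)).
  by exists (face_edge (sval s) ij) => //; exact: smem_act (svalP s).
- by move=> i; apply: sval_inj; exact: (fhom_id (tau1_unit_functor (sval s)) i).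
- by move=> i j k jk ij; apply: sval_inj; exact: (fhom_comp (tau1_unit_functor (sval s)) jk ij).
Defined.

Lemma to_edge_subcategoryE n (s : D n) :
  nerve_map (subcat_incl edge_subcategory) n (to_edge_subcategory_at s) =
  tau1_unit C n (sval s).
Proof. exact: functor_ext. Qed.

Definition to_edge_subcategory : smap D (nerve edge_subcategory).
Proof.
exists to_edge_subcategory_at => m n f s.
apply: (@subcat_incl_mono _ _ edge_subcategory).
rewrite -[LHS]/(nerve_map (subcat_incl edge_subcategory) m _) to_edge_subcategoryE.
rewrite -[RHS]/(nerve_map (subcat_incl edge_subcategory) m _).
by rewrite [RHS]smap_nat to_edge_subcategoryE -smap_nat.
Defined.

Lemma edge_subcategory_pullback : is_subcategory_of_quasicategory D.
Proof.
exists edge_subcategory, to_edge_subcategory; split.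
  by apply: smap_ext => n s; exact/esym/to_edge_subcategoryE.
move=> T x y xy.
have xyE n (t : T n) : tau1_unit C n (x n t) = nerve_map (subcat_incl edge_subcategory) n (y n t).
  exact: (congr1 (fun u : smap T _ => u n t) xy).
have xD n (t : T n) : smem D (x n t).
  apply: one_full_edges D1 _ _ _ => i j ij.
  apply: (@edge_in_subcategory _ _ (face_edge (x n t) ij)).
  have := congr1 (fun F : functor (ordcat n) (tau1 C) => arr (@fhom (ordcat n) _ F i j ij)) (xyE n t).
  move/esym/sub_hom_arr; apply.
  exact: (svalP (@fhom (ordcat n) _ (y n t) i j ij)).
unshelve epose (z := @SMap T D (fun n t => exist _ (x n t) (xD n t)) _).
  by move=> m n f t; apply: sval_inj; rewrite /= smap_nat.
exists z; split=> [|z' [zx zy]].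
  split; first exact: smap_ext.
  apply: smap_ext => n t; apply: (@subcat_incl_mono _ _ edge_subcategory).
  exact: etrans (to_edge_subcategoryE (z n t)) (xyE n t).
apply: smap_ext => n t; apply: sval_inj.
exact: esym (congr1 (fun u : smap T C => u n t) zx).
Qed.
End ToSubcategory.
End Subcategory.

Theorem proposition4p3 (C : sSet) (C_dag : ssubset C) (hC : is_quasicategory C) :
  is_waldhausen_quasicategory C_dag <-> is_barwick_waldhausen C_dag.
Proof.
split=> [[_ has0 D_qcat D1 D_eq D0 D_ex D_po]|[_ D_core [A [l lP]] has0 D0 D_ex D_po]].
  split=> //.
    by move=> n s sE; apply/D1 => u; exact/D_eq/sE.
  apply: edge_subcategory_pullback => // x y e' e e'e e'D.
  exact: D_po e'D (homotopic_pushout hC e'e).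
have memD := pullback_mem lP.
split=> //.
- exact: subcategory_quasicategory memD.
- exact: subcategory_one_full memD.
- by move=> f /core_edge; exact: D_core.
Qed.
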